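(* Let $K,L\subset\mathbb{R}^n$ be convex bodies and let $\lambda\in(0,1)$. Then $$\mathcal{W}\bigl((1-\lambda)K+\lambda L\bigr)^{1/n}\geq\frac{1}{(n!)^{1/n}}\left((1-\lambda)\,\mathcal{W}(K)^{1/n}+\lambda\,\mathcal{W}(L)^{1/n}\right),$$ where $\mathcal{W}$ is the Wills functional.
   Context: A convex body in $\mathbb{R}^n$ is a non-empty compact convex set; $+$ between sets is Minkowski addition; $\mathrm{vol}$ is $n$-dimensional Lebesgue measure. With $B_2^n$ the Euclidean unit ball and $\kappa_j=\mathrm{vol}_j(B_2^j)=\pi^{j/2}/\Gamma(j/2+1)$, the intrinsic volumes $\mathrm{V}_i(K)$, $0\le i\le n$, of a convex body $K$ are defined by the Steiner formula $\mathrm{vol}(K+\lambda B_2^n)=\sum_{i=0}^n\kappa_{n-i}\mathrm{V}_i(K)\lambda^{n-i}$ for all $\lambda\geq 0$. The Wills functional is $\mathcal{W}(K)=\sum_{i=0}^n\mathrm{V}_i(K)$; equivalently, $\mathcal{W}(K)=\int_{\mathbb{R}^n}e^{-\pi d(x,K)^2}\,dx$, where $d(x,K)$ is the Euclidean distance from $x$ to $K$. *)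

(* Defs.v *)
From HB Require Import structures.
From mathcomp Require Import all_boot all_order all_algebra.
From mathcomp Require Import all_classical all_reals all_analysis.

Set Implicit Arguments.
Unset Strict Implicit.
Unset Printing Implicit Defensive.

Import Order.TTheory GRing.Theory Num.Theory.
Import numFieldNormedType.Exports.

Local Open Scope classical_set_scope.
Local Open Scope ring_scope.

(* n-dimensional Lebesgue measure. The library only has it for n = 1; here it is
   the n-fold product measure, carried by the measurable space of n-tuples. *)

Definition consT (R : realType) (n : nat)
    (p : measurableTypeR R * n.-tuple (measurableTypeR R)) :
    n.+1.-tuple (measurableTypeR R) := [the n.+1.-tuple _ of p.1 :: p.2].

Lemma measurable_consT (R : realType) (n : nat) :
  measurable_fun [set: measurableTypeR R * n.-tuple (measurableTypeR R)]
    (@consT R n).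
Proof. exact: measurable_cons. Qed.

Section prod_leb.
Context (R : realType) (n : nat).
Variable m :
  {sigma_finite_measure set (n.-tuple (measurableTypeR R)) -> \bar R}.

Definition prod_leb : set (n.+1.-tuple (measurableTypeR R)) -> \bar R :=
  pushforward (lebesgue_measure \x m)%E (@consT R n).

Let measurable_preimage_consT A : measurable A ->
  measurable (@consT R n @^-1` A).
Proof. by move=> mA; rewrite -[X in measurable X]setTI; exact: measurable_consT. Qed.

Let prod_leb0 : prod_leb set0 = 0%E.
Proof. by rewrite /prod_leb /pushforward preimage_set0 measure0. Qed.

Let prod_leb_ge0 A : (0 <= prod_leb A)%E.
Proof. by rewrite /prod_leb /pushforward measure_ge0. Qed.

Let prod_leb_sigma_additive : semi_sigma_additive prod_leb.
Proof.
move=> F mF tF mUF; rewrite /prod_leb /pushforward preimage_bigcup.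
apply: (@measure_semi_sigma_additive _ _ _ (lebesgue_measure \x m)%E).
- by move=> i; exact: measurable_preimage_consT.
- apply/trivIsetP => /= i j _ _ ij; rewrite -preimage_setI.
  by move/trivIsetP : tF => /(_ _ _ _ _ ij) ->//; rewrite preimage_set0.
- by rewrite -preimage_bigcup; exact: measurable_preimage_consT.
Qed.

HB.instance Definition _ := isMeasure.Build _ _ _ prod_leb
  prod_leb0 prod_leb_ge0 prod_leb_sigma_additive.

Let prod_leb_sigma_finite : sigma_finite [set: _] prod_leb.
Proof.
have /sigma_finiteP[F [TF ndF Foo]] :=
  sigma_finiteT (@lebesgue_measure R : {sigma_finite_measure set _ -> \bar R}).
have /sigma_finiteP[G [TG ndG Goo]] := sigma_finiteT m.
pose unconsT (t : n.+1.-tuple (measurableTypeR R)) :=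
  (thead t : measurableTypeR R, [tuple of behead t]).
have consTK : cancel (@consT R n) unconsT.
  move=> [x t]; rewrite /unconsT /consT /= theadE; congr pair.
  exact/val_inj.
have munconsT : measurable_fun [set: _] unconsT.
  apply/measurable_fun_pairP; split; first exact: measurable_tnth.
  exact: measurable_behead.
exists (fun k => unconsT @^-1` (F k `*` G k)).
  apply/seteqP; split=> // t _.
  have [k _ Fk] : (\bigcup_k F k) (unconsT t).1 by rewrite -TF.
  have [l _ Gl] : (\bigcup_l G l) (unconsT t).2 by rewrite -TG.
  exists (maxn k l) => //; split.
    by move: Fk; exact/subsetPset/ndF/leq_maxl.
  by move: Gl; exact/subsetPset/ndG/leq_maxr.
move=> k; have [mF Fk] := Foo k; have [mG Gk] := Goo k; split.
  by rewrite -[X in measurable X]setTI; apply: munconsT => //; exact: measurableX.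
rewrite /prod_leb /pushforward -comp_preimage (_ : unconsT \o @consT R n = id).
  by rewrite preimage_id product_measure1E// lte_mul_pinfty// ge0_fin_numE.
exact/funext.
Qed.

HB.instance Definition _ := Measure_isSigmaFinite.Build _ _ _ prod_leb
  prod_leb_sigma_finite.

End prod_leb.

Fixpoint lebesgue_tuple (R : realType) (n : nat) :
    {sigma_finite_measure set (n.-tuple (measurableTypeR R)) -> \bar R} :=
  if n is n'.+1 then prod_leb (lebesgue_tuple R n')
  else \d_([tuple] : 0.-tuple (measurableTypeR R)).

Definition vol (R : realType) (n : nat) (A : set 'rV[R]_n) : \bar R :=
  lebesgue_tuple R n [set t | A (\row_i tnth t i)].

Definition minkowski_sum (R : realType) (n : nat) (A B : set 'rV[R]_n) :
    set 'rV[R]_n :=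
  [set x + y | x in A & y in B].

Definition dilate (R : realType) (n : nat) (a : R) (A : set 'rV[R]_n) :
    set 'rV[R]_n :=
  [set a *: x | x in A].

(* The library norm on 'rV[R]_n is the sup norm, hence the explicit sum. *)
Definition ball2 (R : realType) (n : nat) : set 'rV[R]_n :=
  [set x | Num.sqrt (\sum_i x 0 i ^+ 2) <= 1].

Definition convex_body (R : realType) (n : nat) (K : set 'rV[R]_n) : Prop :=
  [/\ K !=set0, compact K & convex_set (K : set (convex_lmodType 'rV[R]_n))].

Definition kappa (R : realType) (j : nat) : R := fine (vol (@ball2 R j)).

Definition steiner_formula (R : realType) (n : nat) (K : set 'rV[R]_n)
    (V : 'I_n.+1 -> R) : Prop :=
  forall lambda : R, 0 <= lambda ->
    vol (minkowski_sum K (dilate lambda (@ball2 R n))) =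
    (\sum_(i < n.+1) kappa R (n - i) * V i * lambda ^+ (n - i))%:E.

(* A convex body satisfies [steiner_formula] for exactly one [V], which [xget]
   selects; the default value is only returned when there is no such [V]. *)
Definition intrinsic_volume (R : realType) (n : nat) (K : set 'rV[R]_n) :
    'I_n.+1 -> R :=
  xget (fun=> 0) [set V | steiner_formula K V].

Definition wills (R : realType) (n : nat) (K : set 'rV[R]_n) : R :=
  \sum_(i < n.+1) intrinsic_volume K i.

(* Main.v *)
Require Import Defs.
From mathcomp Require Import all_boot all_order all_algebra.
From mathcomp Require Import all_classical all_reals all_analysis.
From mathcomp Require Import measurable_realfun qpoly ring lra.
From mathcomp Require finmap.

(* Write p_K(s) = vol(K + s B) for the Euclidean ball B.

   Steiner's formula. For K convex, t |-> vol(K + t [0, v]) is affine: the part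
   newly covered when the segment grows from s to s + t is a translate of the part
   covered when it grows from 0 to t, so the increment solves Cauchy's functional
   equation. Hence s |-> vol(K + s Z) is a polynomial for every finite sum Z of
   segments, of degree at most n by its growth. Averaging the support function of
   such a zonotope over the reflections given by a finite net of the sphere
   shrinks its oscillation there, so zonotopes approximate B, and p_K is a
   pointwise limit of polynomials of degree at most n.

   Positivity. By Tonelli on the subgraph of exp(-|x|^2), the numbers 1 / kappa_j
   are the moments of a probability measure mu on [0, +oo[, so that W(K) is the
   integral of p_K against mu.

   Inequality. X + Y contains translates of X and of Y that only meet in a
   hyperplane, so vol(X + Y) >= vol X + vol Y. With M = (1 - l) K + l L this gives
   p_M >= (1 - l)^n p_K + l^n p_L, and integrating,
   W(M) >= (1 - l)^n W(K) + l^n W(L). Conclude with (x + y)^n <= n! (x^n + y^n). *)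

Set Implicit Arguments.
Unset Strict Implicit.
Unset Printing Implicit Defensive.

Import Order.TTheory GRing.Theory Num.Theory.
Import numFieldNormedType.Exports.

Local Open Scope classical_set_scope.
Local Open Scope ring_scope.

(** * Lebesgue measure on tuples *)

Section affine_change.
Context {R : realType}.
Implicit Types (a b : R).

Let mR := measurableTypeR R.

Lemma measurable_affine a b : measurable_fun [set: mR] (fun x : mR => a * x + b : mR).
Proof.
apply: measurable_funD; last exact: measurable_cst.
exact: measurable_funM.
Qed.

(** By uniqueness of Lebesgue measure: [a] times its pushforward under the affine map agrees with it
    on half-open intervals. *)
Lemma lebesgue_measure_affine a b (A : set mR) : 0 < a -> measurable A ->
  lebesgue_measure ((fun x : mR => a * x + b) @^-1` A) =
  (a^-1%:E * lebesgue_measure A)%E.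
Proof.
move=> a0 mA.
have a'0 : 0 <= a by exact: ltW.
pose k : {nonneg R} := NngNum a'0.
have mf := measurable_affine a b.
suff -> : lebesgue_measure A = (a%:E * lebesgue_measure ((fun x : mR => a * x + b)%R @^-1` A))%E.
  by rewrite muleA -EFinM /= mulVf ?gt_eqF// mul1e.
apply: (@lebesgue_measure_unique R (mscale k (pushforward (@lebesgue_measure R) (fun x : mR => a * x + b : mR)))) => // _ [[x y]] _ <-.
rewrite /= /mscale /= /pushforward.
rewrite (_ : _ @^-1` _ = `](x - b) / a, (y - b) / a]%classic); last first.
  apply/seteqP; split => z /=; rewrite !in_itv /= ltr_pdivrMr// ler_pdivlMr// ltrBlDr lerBrDr (mulrC z)//.
rewrite !lebesgue_measure_itv/= !lte_fin ltr_pM2r ?invr_gt0// ltrD2r.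
case: ifP => _; last by rewrite mule0.
by rewrite -EFinD -EFinM; congr EFin; field; rewrite gt_eqF.
Qed.

Lemma ge0_integral_affine a b (h : mR -> \bar R) : 0 < a ->
  measurable_fun setT h -> (forall x, 0 <= h x)%E ->
  (\int[lebesgue_measure]_x h (a * x + b)%R =
   a^-1%:E * \int[lebesgue_measure]_x h x)%E.
Proof.
move=> a0 mh h0.
have a'0 : 0 <= a^-1 by rewrite invr_ge0 ltW.
transitivity (\int[pushforward (@lebesgue_measure R) (fun x : mR => (a * x + b)%R : mR)]_x h x)%E.
  by rewrite ge0_integral_pushforward ?preimage_setT//; exact: measurable_affine.
rewrite (eq_measure_integral (mscale (NngNum a'0) (@lebesgue_measure R))).
  by rewrite ge0_integral_mscale.
  exact: measurable_affine.
move=> mf A mA _ /=; rewrite /mscale /= /pushforward.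
exact: lebesgue_measure_affine.
Qed.

End affine_change.

Section tuple_measure.
Context {R : realType}.
Let mR := measurableTypeR R.

Definition aff_tuple n (a : R) (b : 'I_n -> R) (t : n.-tuple mR) : n.-tuple mR :=
  [tuple a * tnth t i + b i | i < n].

Lemma aff_tuple_consT n a (b : 'I_n.+1 -> R) (x : mR) (t : n.-tuple mR) :
  aff_tuple a b (consT (x, t)) =
  consT (a * x + b ord0, aff_tuple a (b \o lift ord0) t).
Proof.
apply: eq_from_tnth => i; rewrite tnth_mktuple.
case: (unliftP ord0 i) => [j|] ->; last by rewrite !tnth0.
by rewrite !tnthS tnth_mktuple.
Qed.

Lemma lebesgue_tupleS n (A : set (n.+1.-tuple mR)) :
  lebesgue_tuple R n.+1 A =
  (\int[lebesgue_measure]_x lebesgue_tuple R n [set t | A (consT (x, t))])%E.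
Proof.
rewrite /= /prod_leb /pushforward /product_measure1.
by apply: eq_integral => x _ /=; congr (lebesgue_tuple R n _); apply/seteqP; split => t /=; rewrite xsectionE.
Qed.

Lemma measurable_consT_section n (A : set (n.+1.-tuple mR)) (x : mR) :
  measurable A -> measurable [set t | A (consT (x, t))].
Proof.
move=> mA; have : measurable (consT (n := n) @^-1` A).
  by rewrite -[X in measurable X]setTI; exact: measurable_consT.
move=> /(measurable_xsection x); congr measurable.
by apply/seteqP; split => t /=; rewrite xsectionE.
Qed.

Lemma measurable_fun_consT_section n (A : set (n.+1.-tuple mR)) : measurable A ->
  measurable_fun [set: mR] (fun x => lebesgue_tuple R n [set t | A (consT (x, t))]).
Proof.
move=> mA; have mB : measurable (consT (n := n) @^-1` A).
  by rewrite -[X in measurable X]setTI; exact: measurable_consT.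
have := measurable_fun_xsection (lebesgue_tuple R n) mB.
congr measurable_fun; apply/funext => x /=; congr (lebesgue_tuple R n _).
by apply/seteqP; split => t /=; rewrite xsectionE.
Qed.

(** Induction on the dimension: slicing along the first coordinate, the one-dimensional change of
    variables contributes one factor [a^-1]. *)
Lemma lebesgue_tuple_affine n a (b : 'I_n -> R) (A : set (n.-tuple mR)) :
  0 < a -> measurable A ->
  lebesgue_tuple R n (aff_tuple a b @^-1` A) =
  ((a ^- n)%:E * lebesgue_tuple R n A)%E.
Proof.
move=> a0; elim: n b A => [|n IH] b A mA.
  rewrite expr0 invr1 mul1e; congr (lebesgue_tuple R 0 _).
  by apply/seteqP; split => t /=; rewrite (tuple0 (aff_tuple _ _ _)) (tuple0 t).
rewrite !lebesgue_tupleS.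
under eq_integral => x _.
  rewrite (_ : [set t | _] = aff_tuple a (b \o lift ord0) @^-1`
     [set t | A (consT (a * x + b ord0, t))]); last first.
    by apply/seteqP; split => t /=; rewrite aff_tuple_consT.
  rewrite IH; last exact: measurable_consT_section.
  over.
rewrite (@ge0_integral_affine R a (b ord0) (fun x => (a ^- n)%:E * lebesgue_tuple R n [set t | A (consT (x, t))])%E)//.
- rewrite ge0_integralZl//.
  + by rewrite muleA -EFinM exprS invfM.
  + exact: measurable_fun_consT_section.
  + by rewrite lee_fin invr_ge0 exprn_ge0// ltW.
- apply: measurable_funeM; exact: measurable_fun_consT_section.
- by move=> x; rewrite mule_ge0// lee_fin invr_ge0 exprn_ge0// ltW.
Qed.

(** Serves to show that compact sets have finite volume. *)
Lemma lebesgue_tuple_box n (c : R) : 0 <= c ->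
  lebesgue_tuple R n [set t | forall i, tnth t i \in `[- c, c]] =
  ((2 * c) ^+ n)%:E.
Proof.
move=> c0; elim: n => [|n IH].
  rewrite expr0 /= diracE mem_set//; by case.
rewrite lebesgue_tupleS.
transitivity (\int[lebesgue_measure]_(x in `[(- c)%R, c]) ((2 * c) ^+ n)%:E)%E.
  rewrite [RHS]integral_mkcond; apply: eq_integral => x _.
  rewrite patchE mem_setE; case: ifPn => xc.
    rewrite -IH; congr (lebesgue_tuple R n _); apply/seteqP; split => t /= h i.
      by have := h (lift ord0 i); rewrite tnthS.
    by case: (unliftP ord0 i) => [j|] ->; rewrite ?tnthS ?tnth0.
  rewrite -[RHS](measure0 (lebesgue_tuple R n)); congr (lebesgue_tuple R n _).
  rewrite -subset0 => t /= /(_ ord0); rewrite tnth0 => h; by rewrite h in xc.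
rewrite integral_cst// [X in (_ * X)%E]lebesgue_measure_itv /= lte_fin.
have [c1|c1] := ltrP (- c) c.
  by rewrite -EFinD -EFinM exprS opprK; congr EFin; ring.
have -> : c = 0 by lra.
by rewrite mule0 mulr0 exprS mul0r.
Qed.

Lemma lebesgue_tuple_hyperplane n (c : R) :
  lebesgue_tuple R n.+1 [set t | tnth t ord0 = c] = 0%E.
Proof.
rewrite lebesgue_tupleS.
transitivity (\int[lebesgue_measure]_(x in [set c]) lebesgue_tuple R n setT)%E.
  rewrite [RHS]integral_mkcond; apply: eq_integral => x _.
  rewrite patchE; case: ifPn => [|]; rewrite ?inE ?notin_setE /= => xc.
    by congr (lebesgue_tuple R n _); apply/seteqP; split => t /=; rewrite tnth0.
  rewrite -[RHS](measure0 (lebesgue_tuple R n)); congr (lebesgue_tuple R n _).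
  by rewrite -subset0 => t /=; rewrite tnth0.
by rewrite integral_cst//= lebesgue_measure_set1 mule0.
Qed.

End tuple_measure.

(** * Volume on row vectors *)

Section vol_theory.
Context {R : realType}.
Implicit Types n : nat.
Let mR := measurableTypeR R.

Definition rowt n (t : n.-tuple mR) : 'rV[R]_n := \row_i tnth t i.

Lemma measurable_rowt_ball n (q : 'rV[R]_n) (e : R) :
  measurable [set t | ball q e (rowt t)].
Proof.
have [e0|e0] := ltP 0 e; last first.
  rewrite (_ : mkset _ = set0) ?measurable0// -subset0 => t /= [].
  by rewrite ltNge e0.
rewrite (_ : mkset _ = \bigcap_(i in [set: 'I_n])
    ((fun t : n.-tuple mR => tnth t i) @^-1` ball (q ord0 i) e)).
  apply: fin_bigcap_measurable => [|i _]; first exact: finite_finset.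
  rewrite -[X in measurable X]setTI; apply: measurable_tnth => //.
  exact: measurable_ball.
apply/seteqP; split => [t /= [_ h] i _ /=|t /= h].
  by have := h ord0 i; rewrite mxE.
by split => // i j; rewrite ord1 mxE; exact: h.
Qed.

(** Tuples carry the product sigma-algebra, so [C] is rebuilt from countably many cubes: for each
    radius [e k], take the union of the balls with rational centre that meet [C]. The intersection
    over [k] is the closure of [C]. *)
Lemma closed_measurable_rowt n (C : set 'rV[R]_n) :
  closed C -> measurable (@rowt n @^-1` C).
Proof.
move=> cC.
pose e k : R := k.+1%:R^-1.
have e0 k : 0 < e k by rewrite invr_gt0.
pose rq (q : 'rV[rat]_n) : 'rV[R]_n := map_mx ratr q.
pose F k (q : 'rV[rat]_n) : set 'rV[R]_n :=
  [set x | (exists2 c, C c & ball (rq q) (e k) c) /\ ball (rq q) (e k) x].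
have -> : C = \bigcap_k \bigcup_q F k q.
  apply/seteqP; split=> [x Cx k _|x h].
    have /choice [q hq] (i : 'I_n) : exists q : rat, ball (ratr q : R) (e k) (x ord0 i).
      have [|q] := @rat_in_itvoo R (x ord0 i - e k) (x ord0 i + e k).
        by have := e0 k; lra.
      rewrite in_itv /= => /andP[q1 q2]; exists q.
      by rewrite /ball /= ltr_norml; lra.
    have bx : ball (rq (\row_i q i)) (e k) x.
      by split => // i j; rewrite ord1 !mxE.
    by exists (\row_i q i) => //; split => //; exists x.
  rewrite (iffLR (closure_id C) cC) => B /nbhs_ballP[r /= r0 rB].
  have [k kr] : exists k, e k < r / 2.
    have r20 : 0 < r / 2 by rewrite divr_gt0.
    have := ltr_add_invr r20; rewrite /e => -[k]; rewrite add0r; by exists k.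
  have [q _ [[c Cc qc] qx]] := h k I.
  exists c; split => //; apply: rB.
  apply: (@le_ball _ _ _ (e k + e k)); first by lra.
  exact: ball_triangle (ball_sym qx) qc.
rewrite preimage_bigcap; apply: bigcapT_measurable => k.
rewrite preimage_bigcup; apply: countable_bigcupT_measurable => // q.
have [qC|qC] := pselect (exists2 c, C c & ball (rq q) (e k) c).
  rewrite (_ : _ @^-1` _ = [set t | ball (rq q) (e k) (rowt t)]).
    exact: measurable_rowt_ball.
  by apply/seteqP; split => t /=; [case|].
by rewrite (_ : _ @^-1` _ = set0) ?measurable0// -subset0 => t /= [].
Qed.

Lemma compact_closed_rV n (C : set 'rV[R]_n) : compact C -> closed C.
Proof. by apply: compact_closed; exact: norm_hausdorff. Qed.

Lemma compact_measurable_rowt n (C : set 'rV[R]_n) :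
  compact C -> measurable (@rowt n @^-1` C).
Proof. by move=> /compact_closed_rV; exact: closed_measurable_rowt. Qed.

Lemma vol_ge0 n (A : set 'rV[R]_n) : (0 <= vol A)%E.
Proof. exact: measure_ge0. Qed.

Lemma vol_le n (A B : set 'rV[R]_n) : measurable (@rowt n @^-1` A) ->
  measurable (@rowt n @^-1` B) -> A `<=` B -> (vol A <= vol B)%E.
Proof.
by move=> mA mB AB; apply: le_measure; rewrite ?inE// => t; exact: AB.
Qed.

Lemma preimage_rowt_affine n (a : R) (v : 'rV[R]_n) (A : set 'rV[R]_n) :
  a != 0 -> @rowt n @^-1` [set a *: x + v | x in A] =
  aff_tuple a^-1 (fun i => - (a^-1 * v ord0 i)) @^-1` (@rowt n @^-1` A).
Proof.
move=> a0; apply/seteqP; split => t /=.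
  move=> [x Ax xt]; suff -> : rowt (aff_tuple a^-1 (fun i => - (a^-1 * v ord0 i)) t) = x by [].
  apply/rowP => i; rewrite mxE tnth_mktuple.
  have <- : rowt t ord0 i = tnth t i by rewrite mxE.
  by rewrite -xt !mxE; field.
move=> At; exists (rowt (aff_tuple a^-1 (fun i => - (a^-1 * v ord0 i)) t)) => //.
by apply/rowP => i; rewrite !mxE tnth_mktuple; field.
Qed.

Lemma vol_affine n (a : R) (v : 'rV[R]_n) (A : set 'rV[R]_n) : 0 < a ->
  measurable (@rowt n @^-1` A) ->
  vol [set a *: x + v | x in A] = ((a ^+ n)%:E * vol A)%E.
Proof.
move=> a0 mA; rewrite /vol -/(_ @^-1` _) [X in lebesgue_tuple R n X]preimage_rowt_affine ?gt_eqF//.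
by rewrite lebesgue_tuple_affine ?invr_gt0// exprVn invrK.
Qed.

Lemma vol_compact_fin n (A : set 'rV[R]_n) : compact A -> vol A \is a fin_num.
Proof.
move=> cA; have [M [Mr MA]] := compact_bounded cA.
pose c := Num.max 0 (M + 1).
have c0 : 0 <= c by rewrite le_max lexx.
have Mc : M < c by rewrite lt_max ltrDl ltr01 orbT.
rewrite ge0_fin_numE ?vol_ge0//.
apply: (@le_lt_trans _ _ (lebesgue_tuple R n [set t | forall i, tnth t i \in `[- c, c]])); last first.
  by rewrite lebesgue_tuple_box// ltry.
apply: le_measure; rewrite ?inE.
- exact: compact_measurable_rowt.
- rewrite (_ : mkset _ = \bigcap_(i in [set: 'I_n])
    ((fun t : n.-tuple mR => tnth t i) @^-1` `[- c, c]%classic)); last first.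
    by apply/seteqP; split => [t /= h i _|t /= h i]; [exact: h|apply: (h i I)].
  apply: fin_bigcap_measurable => [|i _]; first exact: finite_finset.
  by rewrite -[X in measurable X]setTI; apply: measurable_tnth.
- move=> t /= At i; have := MA _ Mc _ At => /=.
  rewrite {1}/Num.norm /= mx_normrE => h.
  rewrite in_itv /= -ler_norml; apply: le_trans h.
  have -> : tnth t i = rowt t ord0 i by rewrite mxE.
  by apply/bigmax_geP; right => /=; exists (ord0, i).
Qed.

(** [fine] turns an infinite volume into 0; on compact sets [volrE] shows that nothing is lost. *)
Definition volr n (A : set 'rV[R]_n) : R := fine (vol A).

Lemma volrE n (A : set 'rV[R]_n) : compact A -> vol A = (volr A)%:E.
Proof. by move=> cA; rewrite /volr fineK// vol_compact_fin. Qed.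

Lemma volr_ge0 n (A : set 'rV[R]_n) : 0 <= volr A.
Proof. exact/fine_ge0/vol_ge0. Qed.

Lemma volr_le n (A B : set 'rV[R]_n) : compact A -> compact B -> A `<=` B ->
  volr A <= volr B.
Proof.
move=> cA cB AB; rewrite -lee_fin -!volrE//.
by apply: vol_le => //; exact: compact_measurable_rowt.
Qed.

Lemma volr_affine n (a : R) (v : 'rV[R]_n) (A : set 'rV[R]_n) : 0 < a ->
  compact A -> volr [set a *: x + v | x in A] = a ^+ n * volr A.
Proof.
move=> a0 cA; rewrite /volr vol_affine//; last exact: compact_measurable_rowt.
by rewrite (volrE cA).
Qed.

(** Translates have the same volume, and finiteness allows subtraction. With [oseg_setD] this yields
    the additivity behind Steiner's formula. *)
Lemma volr_setD n (A B A' B' : set 'rV[R]_n) (v : 'rV[R]_n) :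
  compact A -> compact B -> compact A' -> compact B' ->
  A `<=` B -> A' `<=` B' -> B' `\` A' = [set x + v | x in B `\` A] ->
  volr B' - volr A' = volr B - volr A.
Proof.
move=> cA cB cA' cB' AB AB' e.
have vD (C D : set 'rV[R]_n) : compact C -> compact D -> C `<=` D ->
    (volr D - volr C)%:E = vol (D `\` C).
  move=> cC cD CD; rewrite EFinB -!volrE//.
  rewrite [RHS](_ : _ = lebesgue_tuple R n ((@rowt n @^-1` D) `\` (@rowt n @^-1` C)))//.
  have mC := compact_measurable_rowt cC; have mD := compact_measurable_rowt cD.
  rewrite measureD// ?setIidr//; first by move=> t; exact: CD.
  by rewrite -ge0_fin_numE; [exact: (vol_compact_fin cD)|exact: vol_ge0].
apply: EFin_inj; rewrite !vD// e.
have -> : [set x + v | x in B `\` A] = [set 1 *: x + v | x in B `\` A].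
  by congr image; apply/funext => x; rewrite scale1r.
rewrite vol_affine ?expr1n ?mul1e//.
rewrite (_ : _ @^-1` _ = (@rowt n @^-1` B) `\` (@rowt n @^-1` A))//.
by apply: measurableD; exact: compact_measurable_rowt.
Qed.

(** [A] and [B] overlap only within the hyperplane where the first coordinate is [c], a null set. *)
Lemma volr_setU_le n (A B C : set 'rV[R]_n.+1) (c : R) :
  compact A -> compact B -> compact C -> A `<=` C -> B `<=` C ->
  (forall x, A x -> x ord0 ord0 <= c) -> (forall x, B x -> c <= x ord0 ord0) ->
  volr A + volr B <= volr C.
Proof.
move=> cA cB cC AC BC Ac Bc; rewrite -lee_fin EFinD -!volrE//.
have mA := compact_measurable_rowt cA; have mB := compact_measurable_rowt cB.
have mC := compact_measurable_rowt cC.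
apply: (@le_trans _ _ (vol (A `|` B))); last first.
  by apply: vol_le => //; [exact: measurableU | move=> x []; [exact: AC|exact: BC]].
rewrite [leRHS](_ : _ = lebesgue_tuple R n.+1 ((@rowt n.+1 @^-1` A) `|` (@rowt n.+1 @^-1` B)))//.
rewrite measureUfinl//; last first.
  by rewrite -ge0_fin_numE; [exact: (vol_compact_fin cA) | exact: vol_ge0].
rewrite [X in (_ <= _ - X)%E](_ : _ = 0%E); first by rewrite sube0.
apply: (@subset_measure0 _ _ _ (lebesgue_tuple R n.+1) _ [set t | tnth t ord0 = c]).
- exact: measurableI.
- rewrite (_ : mkset _ = (fun t : n.+1.-tuple mR => tnth t ord0) @^-1` [set c])//.
  by rewrite -[X in measurable X]setTI; apply: measurable_tnth.
- move=> t [/= At Bt]; apply/eqP; rewrite eq_le.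
  by have := Ac _ At; have := Bc _ Bt; rewrite !mxE => -> ->.
- exact: lebesgue_tuple_hyperplane.
Qed.

End vol_theory.

(** * Euclidean norm and Minkowski sums *)

Section euclid.
Context {R : realType} {n : nat}.
Implicit Types (x y z u v w : 'rV[R]_n) (a b s t : R).

Definition dot x y : R := \sum_i x ord0 i * y ord0 i.
Definition nrm x : R := Num.sqrt (dot x x).

Lemma dotC x y : dot x y = dot y x.
Proof. by apply: eq_bigr => i _; rewrite mulrC. Qed.

Lemma dotDl x y z : dot (x + y) z = dot x z + dot y z.
Proof. by rewrite -big_split; apply: eq_bigr => i _; rewrite mxE mulrDl. Qed.

Lemma dotZl a x y : dot (a *: x) y = a * dot x y.
Proof. by rewrite big_distrr; apply: eq_bigr => i _; rewrite mxE /= mulrA. Qed.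

Lemma dotDr x y z : dot z (x + y) = dot z x + dot z y.
Proof. by rewrite dotC dotDl !(dotC _ z). Qed.

Lemma dotZr a x y : dot y (a *: x) = a * dot y x.
Proof. by rewrite dotC dotZl (dotC _ y). Qed.

Lemma dotNl x y : dot (- x) y = - dot x y.
Proof. by rewrite -scaleN1r dotZl mulN1r. Qed.

Lemma dotNr x y : dot y (- x) = - dot y x.
Proof. by rewrite dotC dotNl (dotC _ y). Qed.

Lemma dot0l x : dot 0 x = 0.
Proof. by rewrite -(scale0r 0) dotZl mul0r. Qed.

Definition dotE := (dotDl, dotDr, dotZl, dotZr, dotNl, dotNr).

Lemma dot_ge0 x : 0 <= dot x x.
Proof. by apply: sumr_ge0 => i _; rewrite -expr2 sqr_ge0. Qed.

Lemma dot_eq0 x : dot x x = 0 -> x = 0.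
Proof.
move=> /eqP; rewrite psumr_eq0 => [/allP h|i _]; last by rewrite -expr2 sqr_ge0.
apply/rowP => i; have := h i (mem_index_enum _).
by rewrite -expr2 sqrf_eq0 mxE => /eqP.
Qed.

Lemma nrm_ge0 x : 0 <= nrm x. Proof. exact: sqrtr_ge0. Qed.

Lemma sqr_nrm x : nrm x ^+ 2 = dot x x.
Proof. by rewrite sqr_sqrtr// dot_ge0. Qed.

Lemma nrm_eq0 x : nrm x = 0 -> x = 0.
Proof. by move=> h; apply: dot_eq0; rewrite -sqr_nrm h expr0n. Qed.

Lemma nrm0 : nrm 0 = 0. Proof. by rewrite /nrm dot0l sqrtr0. Qed.

Lemma nrmZ a x : nrm (a *: x) = `|a| * nrm x.
Proof.
by rewrite /nrm dotZl dotZr mulrA -expr2 sqrtrM ?sqr_ge0// sqrtr_sqr.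
Qed.

Lemma nrmN x : nrm (- x) = nrm x.
Proof. by rewrite -scaleN1r nrmZ normrN normr1 mul1r. Qed.

Lemma CauchySchwarz x y : dot x y <= nrm x * nrm y.
Proof.
have [/eqP x0|x0] := eqVneq (nrm x) 0.
  by rewrite (nrm_eq0 (eqP x0)) dot0l nrm0 mul0r.
have [/eqP y0|y0] := eqVneq (nrm y) 0.
  by rewrite (nrm_eq0 (eqP y0)) dotC dot0l nrm0 mulr0.
have xp : 0 < nrm x by rewrite lt_neqAle eq_sym x0 nrm_ge0.
have yp : 0 < nrm y by rewrite lt_neqAle eq_sym y0 nrm_ge0.
(* The square expands to 2 |x| |y| (|x| |y| - <x, y>), with |x| |y| > 0. *)
have := dot_ge0 (nrm y *: x - nrm x *: y).
rewrite !dotE -!sqr_nrm (dotC y x) => h.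
have {h} : 0 <= 2 * (nrm x * nrm y) * (nrm x * nrm y - dot x y) by lra.
by rewrite pmulr_rge0 ?mulr_gt0// subr_ge0.
Qed.

Lemma normr_dot_le x y : `|dot x y| <= nrm x * nrm y.
Proof.
rewrite ler_norml CauchySchwarz andbT lerNl -dotNl.
by rewrite -(nrmN x) CauchySchwarz.
Qed.

Lemma nrm_triangle x y : nrm (x + y) <= nrm x + nrm y.
Proof.
rewrite -ler_sqr ?nnegrE ?addr_ge0 ?nrm_ge0// sqr_nrm !dotE sqrrD -!sqr_nrm.
by have := CauchySchwarz x y; rewrite (dotC y x) mulr2n; lra.
Qed.

Lemma coord_le_nrm x i : `|x ord0 i| <= nrm x.
Proof.
rewrite -sqrtr_sqr ler_wsqrtr// /dot (bigD1 i)//= -expr2 lerDl.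
by apply: sumr_ge0 => j _; rewrite -expr2 sqr_ge0.
Qed.

Lemma normr_le_nrm x : `|x| <= nrm x.
Proof.
rewrite /Num.norm /= mx_normrE; apply/bigmax_leP; split; first exact: nrm_ge0.
by move=> [i j] _ /=; rewrite ord1; exact: coord_le_nrm.
Qed.

Lemma continuous_coord i : continuous (fun x => x ord0 i).
Proof. exact: coord_continuous. Qed.

Lemma continuous_nrm : continuous nrm.
Proof.
move=> x; apply: (@continuous_comp _ _ _ (fun x => dot x x)); last exact: sqrt_continuous.
apply: continuous_big => [|i _ {}x]; first exact: add_continuous.
by apply: (@continuousM _ _ (fun x => x ord0 i) (fun x => x ord0 i)); exact: continuous_coord.
Qed.

Lemma ball2E : @ball2 R n = [set x | nrm x <= 1].
Proof.
apply/seteqP; split => x; rewrite /ball2 /= /nrm /dot;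
  by under eq_bigr do rewrite expr2.
Qed.

Lemma dilate_ball2 s : 0 <= s -> dilate s (@ball2 R n) = [set x | nrm x <= s].
Proof.
move=> s0; rewrite ball2E; apply/seteqP; split => x /=.
  by move=> [y /= y1 <-]; rewrite nrmZ ger0_norm// ler_piMr.
move: s0; rewrite le_eqVlt => /predU1P[<- x0|s0 xs].
  exists 0; rewrite /= ?nrm0// scale0r; apply/esym/nrm_eq0/eqP.
  by rewrite eq_le x0 nrm_ge0.
exists (s^-1 *: x); rewrite /= ?scalerA ?divff ?scale1r ?gt_eqF//.
by rewrite nrmZ gtr0_norm ?invr_gt0// mulrC ler_pdivrMr// mul1r.
Qed.

Lemma compact_nrm_le s : compact [set x | nrm x <= s].
Proof.
apply: bounded_closed_compact.
  exists s; split; first exact: num_real.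
  by move=> M sM x /= xs; apply: le_trans (normr_le_nrm x) _; apply: le_trans xs (ltW sM).
rewrite (_ : mkset _ = nrm @^-1` [set a | a <= s])//.
by apply: closed_comp; [move=> x _; exact: continuous_nrm|exact: closed_le].
Qed.

End euclid.

Local Notation msum := (@minkowski_sum _ _).

(** * Minkowski sums, convexity and segments *)

Section minkowski.
Context {R : realType} {n : nat}.
Implicit Types (x y z u v w : 'rV[R]_n) (a b s t : R) (A B C K : set 'rV[R]_n).

Definition cvx A := forall x y t, A x -> A y -> 0 <= t <= 1 ->
  A ((1 - t) *: x + t *: y).

(** Symmetric about the origin, so that for [s >= 0] its support function is s |<v, u>|. The
    one-sided [oseg] is the form whose growth is a translation. *)
Definition seg s v : set 'rV[R]_n := [set c *: v | c in [set c | `|c| <= s]].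

Lemma msumC A B : msum A B = msum B A.
Proof.
by apply/seteqP; split => _ [x Ax [y By <-]]; exists y => //; exists x => //; rewrite addrC.
Qed.

Lemma msumA A B C : msum A (msum B C) = msum (msum A B) C.
Proof.
apply/seteqP; split.
  move=> _ [x Ax [_ [y By [z Cz <-]] <-]]; exists (x + y); first by exists x => //; exists y.
  by exists z => //; rewrite addrA.
move=> _ [_ [x Ax [y By <-]] [z Cz <-]]; exists x => //.
by exists (y + z); [exists y => //; exists z|rewrite addrA].
Qed.

Lemma msumAC A B C : msum (msum A B) C = msum (msum A C) B.
Proof. by rewrite -msumA (msumC B) msumA. Qed.

Lemma msum0 A : msum A [set 0] = A.
Proof.
apply/seteqP; split; first by move=> _ [x Ax [_ -> <-]]; rewrite addr0.
by move=> x Ax; exists x => //; exists 0 => //; rewrite addr0.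
Qed.

Lemma subset_msum A B C : A `<=` B -> msum C A `<=` msum C B.
Proof. by move=> AB _ [x Cx [y /AB By <-]]; exists x => //; exists y. Qed.

Lemma compact_msum A B : compact A -> compact B -> compact (msum A B).
Proof.
move=> cA cB; have -> : msum A B = (fun p => p.1 + p.2) @` (A `*` B).
  apply/seteqP; split; first by move=> _ [x Ax [y By <-]]; exists (x, y).
  by move=> _ [[x y] [Ax By] <-]; exists x => //; exists y.
apply: continuous_compact; last exact: compact_setX.
by apply: continuous_subspaceT => p; exact: add_continuous.
Qed.

Lemma compact_affine a v A : compact A -> compact [set a *: x + v | x in A].
Proof.
move=> cA; apply: continuous_compact => //; apply: continuous_subspaceT => x.
by apply: (@continuousD _ _ _ ( *:%R a) (cst v)); [exact: scaler_continuous|exact: cst_continuous].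
Qed.

Lemma dilateE a A : dilate a A = [set a *: x + 0 | x in A].
Proof. by apply/seteqP; split => _ [x Ax <-]; exists x; rewrite ?addr0. Qed.

Lemma compact_dilate a A : compact A -> compact (dilate a A).
Proof. by rewrite dilateE; exact: compact_affine. Qed.

Lemma cvx_msum A B : cvx A -> cvx B -> cvx (msum A B).
Proof.
move=> cA cB _ _ t [x Ax [y By <-]] [x' Ax' [y' By' <-]] t01.
exists ((1 - t) *: x + t *: x'); first exact: cA.
exists ((1 - t) *: y + t *: y'); first exact: cB.
by rewrite !scalerDr addrACA.
Qed.

Lemma cvx_dilate a A : cvx A -> cvx (dilate a A).
Proof.
move=> cA _ _ t [x Ax <-] [y Ay <-] t01; exists ((1 - t) *: x + t *: y); first exact: cA.
by rewrite scalerDr !scalerA !(mulrC a).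
Qed.

Lemma cvx_seg s v : cvx (seg s v).
Proof.
move=> _ _ t [b /= bs <-] [c /= cs <-] /andP[t0 t1].
exists ((1 - t) * b + t * c); last by rewrite 2!scalerA -scalerDl.
have t1' : 0 <= 1 - t by rewrite subr_ge0.
apply: le_trans (ler_normD _ _) _; rewrite !normrM (ger0_norm t0) (ger0_norm t1').
have := ler_wpM2l t0 cs; have := ler_wpM2l t1' bs; rewrite /=; lra.
Qed.

Lemma compact_seg s v : compact (seg s v).
Proof.
rewrite /seg; apply: continuous_compact.
  by apply: continuous_subspaceT => c; exact: scalel_continuous.
rewrite (_ : mkset _ = `[- s, s]%classic); first exact: segment_compact.
by apply/seteqP; split => c /=; rewrite in_itv /= ler_norml.
Qed.

Lemma convex_body_cvx K : convex_body K -> cvx K.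
Proof.
case=> _ _ cK x y t Kx Ky /andP[t0 t1].
have := cK y x (Itv01 t0 t1) (mem_set Ky) (mem_set Kx); rewrite inE.
by rewrite addrC.
Qed.

End minkowski.

(** * Adding segments *)

Section cauchy_equation.
Context {R : realType}.

(** Nonnegativity makes [f] monotone. Comparing f(N t) with the values at the integers around N t
    gives N |f(t) - t f(1)| <= f(1) for every N. *)
Lemma additive_ge0_linear (f : R -> R) :
  (forall s t, 0 <= s -> 0 <= t -> f (s + t) = f s + f t) ->
  (forall t, 0 <= t -> 0 <= f t) ->
  forall t, 0 <= t -> f t = t * f 1.
Proof.
move=> fD f0.
have fn k s : 0 <= s -> f (k%:R * s) = k%:R * f s.
  move=> s0; elim: k => [|k IH]; last first.
    by rewrite -natr1 !mulrDl !mul1r fD ?IH// mulr_ge0.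
  by have := fD 0 0 (lexx _) (lexx _); rewrite addr0 !mul0r; lra.
have fle s t : 0 <= s -> s <= t -> f s <= f t.
  move=> s0 st; rewrite -(subrK s t) fD ?subr_ge0//.
  by rewrite lerDr f0// subr_ge0.
have key t N : 0 <= t -> `|N%:R * (f t - t * f 1)| <= f 1.
  move=> t0; set m := Num.truncn (N%:R * t).
  have Nt0 : 0 <= N%:R * t by rewrite mulr_ge0.
  have /andP[m1 m2] := Num.Theory.truncn_itv Nt0.
  have h1 := fle _ _ (ler0n _ m) m1.
  have h2 := fle _ _ Nt0 (ltW m2).
  move: h1 h2; rewrite -/m fn// -[m%:R]mulr1 -[m.+1%:R]mulr1 !fn// -natr1 => h1 h2.
  have f1 := f0 1 ler01.
  have h3 := ler_wpM2r f1 m1; have h4 := ler_wpM2r f1 (ltW m2).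
  move: h1 h2 h3 h4; rewrite -/m -natr1 mulrDl mul1r mulrBr (mulrA _ t).
  move: (f 1) f1 (N%:R * f t) (N%:R * t * _) (m%:R * _) => c c0 x y z.
  by rewrite ler_norml; clear; lra.
move=> t t0; apply/eqP; rewrite -subr_eq0; apply/negP => /negP d0.
have d : 0 < `|f t - t * f 1| by rewrite normr_gt0.
have [N hN] : exists N, f 1 < N%:R * `|f t - t * f 1|.
  exists (Num.truncn (f 1 / `|f t - t * f 1|)).+1.
  by rewrite -ltr_pdivrMr// Num.Theory.truncnS_gt.
have := key t N t0; rewrite normrM ger0_norm//; by rewrite leNgt hN.
Qed.

End cauchy_equation.

(** * Volume of a convex body plus a sum of segments *)

Section segment_sum.
Context {R : realType} {n : nat}.
Implicit Types (x y z u v w : 'rV[R]_n) (a b s t : R) (A B C K : set 'rV[R]_n).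

Definition oseg s v : set 'rV[R]_n := [set c *: v | c in [set c | 0 <= c <= s]].

Lemma compact_oseg s v : compact (oseg s v).
Proof.
rewrite /oseg; apply: continuous_compact.
  by apply: continuous_subspaceT => c; exact: scalel_continuous.
rewrite (_ : mkset _ = `[0, s]%classic); first exact: segment_compact.
by apply/seteqP; split => c /=; rewrite in_itv.
Qed.

(* The part of [K] newly covered when the segment grows from [s] to [s + t] is
   the [s *: v]-translate of the part covered when it grows from [0] to [t];
   this is where the convexity of [K] enters. *)
Lemma oseg_setD K v s t : cvx K -> 0 <= s -> 0 <= t ->
  msum K (oseg (s + t) v) `\` msum K (oseg s v) =
  [set x + s *: v | x in msum K (oseg t v) `\` K].
Proof.
move=> cK s0 t0; apply/seteqP; split.
  move=> x [[k Kk [_ [c /= /andP[c0 c1] <-] <-]] nx].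
  have sc : s < c.
    rewrite ltNge; apply/negP => cs; apply: nx; exists k => //.
    by exists (c *: v) => //; exists c => //=; rewrite c0.
  exists (k + (c - s) *: v); last by rewrite -addrA -scalerDl subrK.
  split; first by exists k => //; exists ((c - s) *: v) => //; exists (c - s) => //=; lra.
  move=> h; apply: nx; exists (k + (c - s) *: v) => //; exists (s *: v).
    by exists s => //=; rewrite s0 lexx.
  by rewrite -addrA -scalerDl subrK.
move=> _ [_ [[k Kk [_ [c /= /andP[c0 c1] <-] <-]] nk] <-]; split.
  exists k => //; exists ((c + s) *: v); first by exists (c + s) => //=; lra.
  by rewrite -addrA -scalerDl.
move=> [k' Kk' [_ [c' /= /andP[c'0 c'1] <-] e]]; apply: nk.
have k'E : k' = k + (c + s - c') *: v.
  by rewrite -(addrK (c' *: v) k') e -!addrA -scaleNr -!scalerDl.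
have [c00|cn0] := eqVneq (c + s - c') 0.
  have -> : c = 0 by lra.
  by rewrite scale0r addr0.
have p : 0 < c + s - c' by lra.
(* Since c' <= s, this point lies on the segment from [k] to [k']. *)
have -> : k + c *: v = (1 - c / (c + s - c')) *: k + (c / (c + s - c')) *: k'.
  rewrite k'E scalerDr addrA -scalerDl subrK scale1r scalerA; congr (_ + _ *: _).
  by field; rewrite gt_eqF.
apply: cK => //; rewrite divr_ge0 ?(ltW p)//= ler_pdivrMr// mul1r; lra.
Qed.

Lemma subset_oseg s t v : s <= t -> oseg s v `<=` oseg t v.
Proof.
move=> st _ [c /= /andP[c0 cs] <-]; exists c => //=.
by rewrite c0 (le_trans cs).
Qed.

(** The gained volume [f t] is nonnegative and, by [oseg_setD], additive in [t], hence linear. *)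
Lemma volr_oseg K v t : compact K -> cvx K -> 0 <= t ->
  volr (msum K (oseg t v)) =
  volr K + t * (volr (msum K (oseg 1 v)) - volr K).
Proof.
move=> cK xK; pose f t := volr (msum K (oseg t v)) - volr K.
have cKo s : compact (msum K (oseg s v)) by apply: compact_msum => //; exact: compact_oseg.
have KK s : 0 <= s -> K `<=` msum K (oseg s v).
  by move=> s0 x Kx; exists x => //; exists 0; [exists 0; rewrite /= ?lexx ?scale0r|rewrite addr0].
have fge0 r : 0 <= r -> 0 <= f r.
  by move=> r0; rewrite subr_ge0; apply: volr_le => //; exact: KK.
have fD r s : 0 <= r -> 0 <= s -> f (r + s) = f r + f s.
  move=> r0 s0; have rs : msum K (oseg r v) `<=` msum K (oseg (r + s) v).
    by apply: subset_msum; apply: subset_oseg; rewrite lerDl.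
  have := volr_setD cK (cKo s) (cKo r) (cKo (r + s)) (KK _ s0) rs (oseg_setD v xK r0 s0).
  by rewrite /f => <-; ring.
move=> t0; have := additive_ge0_linear fD fge0 t0; rewrite /f => <-.
by rewrite addrC subrK.
Qed.

Lemma seg_oseg s v : seg s v = [set 1 *: x + - s *: v | x in oseg (2 * s) v].
Proof.
apply/seteqP; split => x.
  move=> [c /=]; rewrite ler_norml => /andP[c1 c2] <-.
  exists ((c + s) *: v); first by exists (c + s) => //=; lra.
  by rewrite scale1r -scalerDl addrK.
move=> [_ [c /= /andP[c1 c2] <-] <-]; exists (c - s) => /=; first by rewrite ler_norml; lra.
by rewrite scale1r -scalerDl.
Qed.

Lemma msum_translate A B v :
  msum A [set 1 *: x + v | x in B] = [set 1 *: x + v | x in msum A B].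
Proof.
apply/seteqP; split.
  move=> _ [x Ax [_ [y By <-] <-]]; exists (x + y); first by exists x => //; exists y.
  by rewrite !scale1r addrA.
move=> _ [_ [x Ax [y By <-]] <-]; exists x => //; exists (1 *: y + v); first by exists y.
by rewrite !scale1r addrA.
Qed.

Lemma volr_seg K v t : compact K -> cvx K -> 0 <= t ->
  volr (msum K (seg t v)) = volr K + t * (volr (msum K (seg 1 v)) - volr K).
Proof.
move=> cK xK t0.
have E s : 0 <= s -> volr (msum K (seg s v)) = volr (msum K (oseg (2 * s) v)).
  move=> s0; rewrite seg_oseg msum_translate volr_affine//.
    by rewrite expr1n mul1r.
  by apply: compact_msum => //; exact: compact_oseg.
rewrite !E// (volr_oseg _ cK xK (_ : 0 <= 2 * t)) ?mulr_ge0//.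
rewrite (volr_oseg _ cK xK (_ : 0 <= 2 * 1)) ?mulr_ge0//.
by move: (volr K) (volr _) => a b; ring.
Qed.

(** For [s >= 0] this is [s] times the zonotope with parameter 1; scaling each segment separately
    allows them to be peeled off one by one. *)
Definition zonotope s (vs : seq 'rV[R]_n) : set 'rV[R]_n :=
  foldr (fun v A => msum (seg s v) A) [set 0] vs.

Lemma compact_zonotope s vs : compact (zonotope s vs).
Proof.
elim: vs => [|v vs IH] /=; first exact: compact_set1.
by apply: compact_msum => //; exact: compact_seg.
Qed.

Lemma cvx_zonotope s vs : cvx (zonotope s vs).
Proof.
elim: vs => [|v vs IH] /=; last by apply: cvx_msum => //; exact: cvx_seg.
by move=> _ _ t -> -> _; rewrite !scaler0 addr0.
Qed.

(** Induction on the segments with [K] varying. The volume is affine in the length of the first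
    segment, and its values at lengths 0 and 1 are the polynomials [p] for [K] and [q] for [K] plus
    a unit copy of that segment. *)
Lemma volr_zonotope_poly K vs : compact K -> cvx K ->
  exists p : {poly R}, forall s, 0 <= s ->
    volr (msum K (zonotope s vs)) = p.[s].
Proof.
elim: vs K => [|v vs IH] K cK xK.
  by exists (volr K)%:P => s _ /=; rewrite msum0 hornerC.
have [p hp] := IH K cK xK.
have [q hq] : exists q : {poly R}, forall s, 0 <= s ->
    volr (msum (msum K (seg 1 v)) (zonotope s vs)) = q.[s].
  apply: IH; first by apply: compact_msum => //; exact: compact_seg.
  by apply: cvx_msum => //; exact: cvx_seg.
exists (p + 'X * (q - p)) => s s0 /=.
rewrite (msumC (seg s v)) msumA volr_seg//.
- by rewrite hp// msumAC hq// !hornerE.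
- by apply: compact_msum => //; exact: compact_zonotope.
- by apply: cvx_msum => //; exact: cvx_zonotope.
Qed.

End segment_sum.

(** * Approximating the ball by zonotopes *)

Section support_function.
Context {R : realType} {n : nat}.
Implicit Types (x y z u v w p q : 'rV[R]_n) (vs ws : seq 'rV[R]_n) (a b s t : R).

(** The support function of [zonotope 1 vs]. *)
Definition supp vs u : R := \sum_(v <- vs) `|dot v u|.

Lemma suppZ vs a u : supp vs (a *: u) = `|a| * supp vs u.
Proof. by rewrite /supp mulr_sumr; apply: eq_bigr => v _; rewrite dotZr normrM. Qed.

Lemma zonotope_dot_le s vs z u : zonotope s vs z -> dot z u <= s * supp vs u.
Proof.
elim: vs z => [|v vs IH] z /=.
  by move=> ->; rewrite dot0l /supp big_nil mulr0.
move=> [_ [c /= cs <-] [y /IH yu <-]]; rewrite dotDl dotZl /supp big_cons mulrDr lerD//.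
by rewrite (le_trans (ler_norm _))// normrM ler_wpM2r.
Qed.

Lemma zonotope_dot_attained s vs u : 0 <= s ->
  exists2 z, zonotope s vs z & dot z u = s * supp vs u.
Proof.
move=> s0; elim: vs => [|v vs [z Zz zu]] /=.
  by exists 0; rewrite // dot0l /supp big_nil mulr0.
exists ((s * Num.sg (dot v u)) *: v + z).
  exists ((s * Num.sg (dot v u)) *: v); last by exists z.
  exists (s * Num.sg (dot v u)) => //=; rewrite normrM ger0_norm// ler_piMr//.
  by rewrite normr_sg lern1 leq_b1.
by rewrite dotDl dotZl zu /supp big_cons mulrDr normrEsg mulrA.
Qed.

Lemma dot_subZ u v t : dot (u - t *: v) (u - t *: v) =
  dot u u - 2 * t * dot v u + t ^+ 2 * dot v v.
Proof. by rewrite !dotE (dotC u v); ring. Qed.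

(* The nearest point of the zonotope to [x] separates [x] from it. *)
Lemma zonotope_separation s vs x : 0 <= s ->
  (forall u, dot x u <= s * supp vs u) -> zonotope s vs x.
Proof.
move=> s0 h.
have [z0 Zz0 _] := zonotope_dot_attained vs 0 s0.
have [p Zp pmin] : exists2 p, p \in zonotope s vs &
    forall z, z \in zonotope s vs -> nrm (x - p) <= nrm (x - z).
  apply: (@compact_EVT_min _ _ (fun z => nrm (x - z))).
  - by exists z0.
  - exact: compact_zonotope.
  - apply: continuous_subspaceT => z.
    apply: (@continuous_comp _ _ _ (fun z => x - z)); last exact: continuous_nrm.
    by apply: (@continuousB _ _ _ (cst x) id); [exact: cst_continuous|].
move: Zp; rewrite inE => Zp; set u := x - p in pmin.
have key z : zonotope s vs z -> dot (z - p) u <= 0.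
  move=> Zz; rewrite leNgt; apply/negP => d0.
  have D t : 0 <= t <= 1 -> 2 * t * dot (z - p) u <= t ^+ 2 * dot (z - p) (z - p).
    move=> t01; have := pmin _ (mem_set (cvx_zonotope Zp Zz t01)).
    rewrite -ler_sqr ?nnegrE ?nrm_ge0// !sqr_nrm.
    have -> : x - ((1 - t) *: p + t *: z) = u - t *: (z - p).
      by rewrite /u; apply/rowP => i; rewrite !mxE; ring.
    rewrite dot_subZ.
    by move: (dot u u) (dot (z - p) u) (dot (z - p) (z - p)) => A B C; lra.
  set e := dot (z - p) u in d0 D; set m := dot (z - p) (z - p) in D.
  have m0 : 0 <= m by exact: dot_ge0.
  (* This [t] lies in ]0, 1] and satisfies t m <= e, whereas [D] would give 2 e <= t m. *)
  pose t := e / (e + m).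
  have em : 0 < e + m by rewrite ltr_wpDr.
  have t0 : 0 < t by rewrite divr_gt0.
  have t1 : t <= 1 by rewrite ler_pdivrMr// mul1r lerDl.
  have := D t; rewrite (ltW t0) t1 => /(_ isT).
  rewrite (mulrC 2) -mulrA expr2 -mulrA ler_pM2l//.
  have : t * m <= e by rewrite mulrAC ler_pdivrMr// mulrDr; have := sqr_ge0 e; rewrite expr2; lra.
  by lra.
(* At a point [z] maximising <z, u>, [key] gives s [supp vs u] <= <p, u>, while <x, u> <= s
   [supp vs u]; hence <u, u> <= 0. *)
have [z Zz zu] := zonotope_dot_attained vs u s0.
have := key _ Zz; rewrite dotDl dotNl zu => k1.
have k2 := h u.
have : dot u u <= 0 by rewrite {1}/u dotDl dotNl; lra.
move=> u0; suff -> : x = p by [].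
apply/eqP; rewrite -subr_eq0; apply/eqP; apply: dot_eq0.
by apply/eqP; rewrite eq_le u0 dot_ge0.
Qed.

(** Reflection in the hyperplane orthogonal to [w]; the identity when [w = 0]. *)
Definition householder w x := x - (2 * dot x w / dot w w) *: w.

Lemma householder_sym w x y : dot (householder w x) y = dot x (householder w y).
Proof. by rewrite /householder !dotE (dotC w y) -!mulrA; congr (_ - 2 * _); ring. Qed.

Lemma householderK w : involutive (householder w).
Proof.
move=> x; rewrite /householder; have [w0|w0] := eqVneq (dot w w) 0.
  by rewrite (dot_eq0 w0) !scaler0 !subr0.
apply/rowP => i; rewrite !dotE !mxE; field; exact: w0.
Qed.

Lemma nrm_householder w x : nrm (householder w x) = nrm x.
Proof. by rewrite /nrm householder_sym householderK. Qed.

Lemma householderB w x y : householder w (x - y) = householder w x - householder w y.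
Proof. by rewrite /householder dotDl dotNl; apply/rowP => i; rewrite !mxE; ring. Qed.

(** Unit vectors are mirror images in their bisecting hyperplane: the coefficient is 1 because |p -
    q|^2 = 2 <p, p - q>. *)
Lemma householder_swap p q : nrm p = 1 -> nrm q = 1 -> householder (p - q) p = q.
Proof.
move=> p1 q1; have [pq|pq] := eqVneq (dot (p - q) (p - q)) 0.
  by rewrite /householder pq invr0 mulr0 scale0r subr0; apply/eqP; rewrite -subr_eq0 (dot_eq0 pq).
have e : dot (p - q) (p - q) = 2 * dot p (p - q).
  rewrite !dotE -!sqr_nrm p1 q1 (dotC q p); ring.
by rewrite /householder -e divff// scale1r opprB addrC subrK.
Qed.

(** A Lipschitz constant of [supp vs]. Averaging over reflections preserves it, which makes the
    averaging iterable. *)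
Definition lips vs : R := \sum_(v <- vs) nrm v.

Lemma lips_ge0 vs : 0 <= lips vs.
Proof. by apply: sumr_ge0 => v _; exact: nrm_ge0. Qed.

Lemma supp_le_lips vs u : supp vs u <= lips vs * nrm u.
Proof. by rewrite /lips mulr_suml; apply: ler_sum => v _; exact: normr_dot_le. Qed.

Lemma supp_lipschitz vs u v : supp vs u <= supp vs v + lips vs * nrm (u - v).
Proof.
apply: (@le_trans _ _ (supp vs v + supp vs (u - v))); last by rewrite lerD2l supp_le_lips.
rewrite -big_split; apply: ler_sum => w _ /=.
have -> : dot w u = dot w v + dot w (u - v) by rewrite -dotDr addrC subrK.
exact: ler_normD.
Qed.

Definition scal a vs := [seq a *: v | v <- vs].

Lemma supp_scal a vs u : 0 <= a -> supp (scal a vs) u = a * supp vs u.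
Proof.
move=> a0; rewrite /supp big_map mulr_sumr; apply: eq_bigr => v _.
by rewrite dotZl normrM ger0_norm.
Qed.

(** Generators of a zonotope whose support function is the mean of [supp vs] over the reflections
    given by [ws]. *)
Definition avg ws vs :=
  [seq (size ws)%:R^-1 *: householder w v | w <- ws, v <- vs].

Lemma supp_avg ws vs u :
  supp (avg ws vs) u = (size ws)%:R^-1 * \sum_(w <- ws) supp vs (householder w u).
Proof.
rewrite /supp big_allpairs_dep mulr_sumr; apply: eq_bigr => w _.
rewrite mulr_sumr; apply: eq_bigr => v _.
by rewrite dotZl normrM ger0_norm ?invr_ge0// householder_sym.
Qed.

Lemma lips_avg ws vs : (0 < size ws)%N -> lips (avg ws vs) = lips vs.
Proof.
move=> w0; rewrite /lips big_allpairs_dep.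
transitivity (\sum_(w <- ws) (size ws)%:R^-1 * lips vs).
  apply: eq_bigr => w _; rewrite mulr_sumr; apply: eq_bigr => v _.
  by rewrite nrmZ nrm_householder ger0_norm ?invr_ge0.
rewrite big_const_seq count_predT iter_addr_0 -(mulr_natl (_ * _)) mulrA mulfV ?mul1r//.
by rewrite pnatr_eq0 -lt0n.
Qed.

Lemma sphere_net (d : R) : 0 < d -> exists ps : seq 'rV[R]_n,
  (forall p, p \in ps -> nrm p = 1) /\
  (forall x, nrm x = 1 -> exists2 p, p \in ps & nrm (x - p) <= d).
Proof.
move=> d0; pose S : set 'rV[R]_n := [set x | nrm x = 1].
have cS : compact S.
  apply: (@subclosed_compact _ _ [set x | nrm x <= 1]).
  - rewrite (_ : S = nrm @^-1` [set 1])//.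
    by apply: closed_comp; [move=> x _; exact: continuous_nrm|exact: closed_eq].
  - exact: compact_nrm_le.
  - by move=> x /= ->.
move: cS; rewrite compact_cover => /(_ _ S (fun p => [set x | nrm (x - p) < d])) [].
- move=> p _; rewrite (_ : mkset _ = (fun x => nrm (x - p)) @^-1` [set a | a < d])//.
  apply: open_comp; last exact: open_lt.
  move=> x _; apply: (@continuous_comp _ _ _ (fun x => x - p)); last exact: continuous_nrm.
  by apply: (@continuousB _ _ _ id (cst p)) => //; exact: cst_continuous.
- by move=> x Sx; exists x => //=; rewrite subrr nrm0.
- move=> D DS SD; exists (finmap.enum_fset D); split; first by move=> p /DS; rewrite inE.
  by move=> x /SD [p /= pD /ltW xp]; exists p.
Qed.

Definition between vs a b := forall u, nrm u = 1 -> a <= supp vs u <= b.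

End support_function.

(** * Shrinking the oscillation of a support function by averaging *)

Section averaging.
Context {R : realType} {n : nat}.
Implicit Types (x y z u v w p q : 'rV[R]_n) (vs ws : seq 'rV[R]_n) (a b s t : R).

(** If [supp vs] is below the midpoint at some [y], every [u] is carried close to [y] by a
    reflection of [ws]. That term of the mean is at most b - e/2 + L d <= b - e/4 and the others are
    at most [b], so the upper bound drops by e/4 over the size of [ws]. Otherwise the lower bound
    rises to the midpoint. *)
Lemma avg_step ws vs a b (L d e : R) : (0 < size ws)%N ->
  (forall x y, nrm x = 1 -> nrm y = 1 ->
     exists2 w, w \in ws & nrm (householder w x - y) <= d) ->
  lips vs <= L -> L * d <= e / 4 -> 0 < e -> between vs a b -> e <= b - a ->
  exists vs' a' b', [/\ lips vs' <= L, between vs' a' b', a <= a' &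
    b' - a' <= b - a - e / 4 / (size ws)%:R].
Proof.
move=> N0 wsd vsL Lde e0 ab eab; set N := (size ws)%:R.
have Np : 0 < N by rewrite ltr0n.
have N1 : 1 <= N by rewrite ler1n.
have d'0 : 0 <= e / 4 / N by rewrite divr_ge0 ?ltW// divr_gt0.
have d'e : e / 4 / N <= e / 4.
  by rewrite ler_pdivrMr// ler_peMr// divr_ge0// ltW.
have [[y [y1 hy]]|nh] := pselect (exists y, nrm y = 1 /\ supp vs y < (a + b) / 2); last first.
  exists vs, ((a + b) / 2), b; split => //; [|lra|lra].
  move=> u u1; have /andP[_ ->] := ab u u1; rewrite andbT leNgt.
  by apply/negP => h; apply: nh; exists u.
exists (avg ws vs), a, (b - e / 4 / N); split; [by rewrite lips_avg| |by []|lra].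
move=> u u1; rewrite supp_avg -/N.
have hw w : a <= supp vs (householder w u) <= b by apply: ab; rewrite nrm_householder.
have Nsum c : \sum_(w <- ws) c = N * c.
  by rewrite big_const_seq count_predT iter_addr_0 -(mulr_natl c).
apply/andP; split.
  rewrite mulrC ler_pdivlMr// mulrC -Nsum; apply: ler_sum => w _.
  by have /andP[] := hw w.
have [w wws hwu] := wsd u y u1 y1.
rewrite mulrC ler_pdivrMr// mulrBl divfK ?gt_eqF// (mulrC b) -Nsum lerBrDr -lerBrDl -sumrB.
rewrite (big_rem w)//= -[leLHS]addr0 lerD//; last first.
  by apply: sumr_ge0 => v _; rewrite subr_ge0; have /andP[] := hw v.
have := supp_lipschitz vs (householder w u) y.
have : lips vs * nrm (householder w u - y) <= L * d.
  by apply: ler_pM => //; [exact: lips_ge0|exact: nrm_ge0].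
by move: (supp _ _) (supp _ _) (lips _ * _) (L * d) hy Lde => A B C D; lra.
Qed.

(** While the oscillation exceeds [e], each step gains the fixed amount [eta], since [ws] and the
    bound [L] stay the same; so finitely many steps suffice. *)
Lemma avg_iter ws vs a b (L d e : R) : (0 < size ws)%N ->
  (forall x y, nrm x = 1 -> nrm y = 1 ->
     exists2 w, w \in ws & nrm (householder w x - y) <= d) ->
  lips vs <= L -> L * d <= e / 4 -> 0 < e -> between vs a b ->
  exists vs' a' b', [/\ between vs' a' b', a <= a' & b' - a' <= e].
Proof.
move=> N0 wsd vsL Lde e0 ab; set eta := e / 4 / (size ws)%:R.
have eta0 : 0 < eta by rewrite !divr_gt0// ltr0n.
have it (k : nat) : exists vs' a' b', [/\ lips vs' <= L, between vs' a' b', a <= a' &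
    b' - a' <= e \/ b' - a' <= b - a - k%:R * eta].
  elim: k => [|k [vs' [a' [b' [l' ab' aa' h]]]]].
    by exists vs, a, b; split => //; right; rewrite mul0r subr0.
  have [be|eb] := lerP (b' - a') e; first by exists vs', a', b'; split => //; left.
  have [vs2 [a2 [b2 [l2 ab2 aa2 h2]]]] := avg_step N0 wsd l' Lde e0 ab' (ltW eb).
  exists vs2, a2, b2; split => //; first exact: le_trans aa2.
  right; apply: le_trans h2 _; rewrite -/eta -natr1 mulrDl mul1r.
  by case: h; lra.
have [vs' [a' [b' [l' ab' aa' h]]]] := it (Num.truncn ((b - a) / eta)).+1.
exists vs', a', b'; split => //; case: h => // h.
have := Num.Theory.truncnS_gt ((b - a) / eta); rewrite ltr_pdivrMr// => h2.
apply: le_trans h _; lra.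
Qed.

(** Start from the cube, whose support function is the sum of the |u_i|, at least 1 on the sphere.
    Averaging brings the oscillation down to [e] with a lower bound [a >= 1]; finally divide by
    [a]. *)
Lemma zonotope_approx (e : R) : 0 < e -> exists vs : seq 'rV[R]_n,
  forall u, nrm u <= supp vs u <= (1 + e) * nrm u.
Proof.
move=> e0; pose vs0 : seq 'rV[R]_n := [seq delta_mx ord0 i | i <- enum 'I_n].
have dot_delta u i : dot (delta_mx ord0 i) u = u ord0 i.
  rewrite /dot (bigD1 i)//= mxE !eqxx mul1r big1 ?addr0// => j ji.
  by rewrite mxE (negbTE ji) andbF mul0r.
have b0 : between vs0 1 (lips vs0).
  move=> u u1; have := supp_le_lips vs0 u; rewrite u1 mulr1 => ->; rewrite andbT.
  have := sqr_nrm u; rewrite u1 expr1n => ->.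
  rewrite /supp big_map big_enum /= [leLHS]/dot; apply: ler_sum => i _; rewrite dot_delta.
  rewrite (le_trans (ler_norm _))// normrM ler_piMl//.
  by have := coord_le_nrm u i; rewrite u1.
set L := lips vs0 in b0; have L0 : 0 <= L := lips_ge0 vs0.
pose d := e / 8 / (L + 1).
have L1 : 0 < L + 1 by lra.
have d0 : 0 < d by rewrite !divr_gt0.
have [ps [ps1 psd]] := @sphere_net R n _ d0.
(* The extra 0 keeps [ws] nonempty even when the sphere is empty. *)
pose ws := 0 :: [seq p - q | p <- ps, q <- ps].
have wsd x y : nrm x = 1 -> nrm y = 1 ->
    exists2 w, w \in ws & nrm (householder w x - y) <= 2 * d.
  (* Reflecting a net point near [x] to a net point near [y] costs at most [d] at either end. *)
  move=> x1 y1; have [p pps xp] := psd x x1; have [q qps yq] := psd y y1.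
  exists (p - q); first by rewrite inE; apply/orP; right; apply/allpairsP; exists (p, q).
  have -> : householder (p - q) x - y = householder (p - q) (x - p) - (y - q).
    by rewrite householderB householder_swap ?ps1// opprB addrA subrK.
  apply: le_trans (nrm_triangle _ _) _; rewrite nrmN nrm_householder; lra.
have Ld : L * (2 * d) <= e / 4.
  have : L * d <= e / 8.
    rewrite /d mulrCA ler_piMr//; first by rewrite divr_ge0// ltW.
    by rewrite ler_pdivrMr// mul1r lerDl.
  lra.
have [//|vs [a [b [ab a1 ba]]]] := avg_iter _ wsd (lexx L) Ld e0 b0.
have a0 : 0 < a by lra.
exists (scal a^-1 vs) => u; rewrite supp_scal ?invr_ge0 ?(ltW a0)//.
have [/eqP u0|u0] := eqVneq (nrm u) 0.
  rewrite (nrm_eq0 (eqP u0)) nrm0 mulr0.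
  have := suppZ vs 0 u; rewrite scale0r normr0 mul0r => ->.
  by rewrite mulr0 lexx.
have up : 0 < nrm u by rewrite lt_neqAle eq_sym u0 nrm_ge0.
have := ab ((nrm u)^-1 *: u); rewrite nrmZ gtr0_norm ?invr_gt0// mulVf// => /(_ erefl).
rewrite suppZ gtr0_norm ?invr_gt0// => /andP[h1 h2].
apply/andP; split.
  rewrite mulrC ler_pdivlMr// mulrC -ler_pdivlMr// mulrC; exact: h1.
rewrite mulrC ler_pdivrMr//.
move: h2; rewrite mulrC ler_pdivrMr// => /le_trans; apply.
(* Here b <= a + e <= (1 + e) a, because a >= 1. *)
rewrite mulrAC ler_pM2r//; nra.
Qed.

End averaging.

(** * Steiner's formula *)

Section poly_lemmas.
Context {R : realType}.

(** Otherwise the degree is d + 1 with d >= n, and for s >= 1 all the remaining terms together with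
    the bound are at most D s^d. So |lead| s <= D, which fails at s = D / |lead| + 1. *)
Lemma size_poly_growth (p : {poly R}) (C : R) (n : nat) :
  (forall s, 0 <= s -> `|p.[s]| <= C * (1 + s) ^+ n) -> (size p <= n.+1)%N.
Proof.
move=> h; rewrite leqNgt; apply/negP => np.
have [d sd] : exists d, size p = d.+2 by exists (size p).-2; case: (size p) np => [|[]].
have nd : (n <= d)%N by move: np; rewrite sd.
pose D := C * 2 ^+ n + \sum_(i < d.+1) `|p`_i|.
have C0 : 0 <= C by have := h 0 (lexx _); rewrite addr0 expr1n mulr1; exact: le_trans.
have c0 : 0 < `|p`_d.+1|.
  rewrite normr_gt0; have := lead_coef_eq0 p; rewrite lead_coefE sd /= => ->.
  by rewrite -size_poly_eq0 sd.
have key s : 1 <= s -> `|p`_d.+1| * s <= D.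
  move=> s1; have s0 : 0 < s by rewrite (lt_le_trans ltr01).
  rewrite -(ler_pM2r (exprn_gt0 d s0)) -mulrA -exprS.
  have -> : `|p`_d.+1| * s ^+ d.+1 = `|p.[s] - \sum_(i < d.+1) p`_i * s ^+ i|.
    rewrite horner_coef sd big_ord_recr /= addrAC subrr add0r normrM.
    by rewrite (ger0_norm (exprn_ge0 _ (ltW s0))).
  apply: le_trans (ler_normB _ _) _; rewrite mulrDl lerD//.
    apply: le_trans (h _ (ltW s0)) _; rewrite -mulrA ler_wpM2l//.
    apply: (@le_trans _ _ ((2 * s) ^+ n)); first by apply: lerXn2r; rewrite ?nnegrE; lra.
    by rewrite exprMn ler_wpM2l// ?exprn_ge0// ler_weXn2l.
  apply: le_trans (ler_norm_sum _ _ _) _; rewrite mulr_suml; apply: ler_sum => i _.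
  rewrite normrM ler_wpM2l// ger0_norm ?exprn_ge0 ?(ltW s0)//.
  by rewrite ler_weXn2l// -ltnS.
have D0 : 0 <= D by rewrite addr_ge0 ?mulr_ge0 ?exprn_ge0// sumr_ge0.
have := key (D / `|p`_d.+1| + 1); rewrite lerDr divr_ge0 ?(ltW c0)// => /(_ isT).
rewrite mulrDr mulrCA divff ?gt_eqF// !mulr1; lra.
Qed.

(** A chord bound on [0, 1]; it makes the error of the squeeze linear in [e]. *)
Lemma exprD1_le (e : R) n : 0 <= e <= 1 -> (1 + e) ^+ n <= 1 + e * (2 ^+ n - 1).
Proof.
move=> /andP[e0 e1]; elim: n => [|n IH]; first by rewrite !expr0 subrr mulr0 addr0.
have e1' : 0 <= 1 + e by lra.
rewrite !exprS; apply: le_trans (ler_wpM2l e1' IH) _.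
have B0 : 0 <= 2 ^+ n - 1 :> R by rewrite subr_ge0 exprn_ege1//; lra.
have eB : e * (e * (2 ^+ n - 1)) <= 1 * (e * (2 ^+ n - 1)).
  by rewrite ler_wpM2r// mulr_ge0.
by move: (2 ^+ n) eB {B0 IH} => B; lra.
Qed.

End poly_lemmas.

(** * Volumes of parallel bodies are polynomial *)

Section steiner.
Context {R : realType} {n : nat}.
Implicit Types (x y z u v w p q : 'rV[R]_n) (vs ws : seq 'rV[R]_n) (a b s t : R)
  (K : set 'rV[R]_n).

Definition sball s : set 'rV[R]_n := [set x | nrm x <= s].

Definition parallel_vol K s := volr (msum K (sball s)).

Lemma compact_sball s : compact (sball s).
Proof. exact: compact_nrm_le. Qed.

Lemma dilate_sball a s : 0 < a -> dilate a (sball s) = sball (a * s).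
Proof.
move=> a0; apply/seteqP; split.
  by move=> _ [x xs <-]; rewrite /sball /= nrmZ gtr0_norm// ler_pM2l.
move=> x xs; exists (a^-1 *: x); last by rewrite scalerA divff ?scale1r// gt_eqF.
by rewrite /sball /= nrmZ gtr0_norm ?invr_gt0// mulrC ler_pdivrMr// mulrC.
Qed.

Lemma volr_sball s : 0 < s -> volr (sball s) = s ^+ n * volr (sball 1).
Proof.
move=> s0; rewrite -[in LHS](mulr1 s) -dilate_sball// dilateE volr_affine//.
exact: compact_sball.
Qed.

Lemma compact_parallel K s : compact K -> compact (msum K (sball s)).
Proof. by move=> cK; apply: compact_msum => //; exact: compact_sball. Qed.

(** With [p] a farthest point of [K] from the origin, the parallel body lies in the ball of radius
    (|p| + 1)(1 + s). *)
Lemma parallel_vol_growth K : compact K ->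
  exists2 C, 0 <= C & forall s, 0 <= s -> parallel_vol K s <= C * (1 + s) ^+ n.
Proof.
move=> cK; have [->|/set0P K0] := eqVneq K set0.
  exists 0 => // s s0; rewrite /parallel_vol (_ : msum _ _ = set0) ?mul0r.
    by rewrite /volr /vol measure0.
  by rewrite -subset0 => x [].
have [p _ pmax] : exists2 p, p \in K & forall z, z \in K -> nrm z <= nrm p.
  apply: compact_EVT_max => //; apply: continuous_subspaceT; exact: continuous_nrm.
exists ((nrm p + 1) ^+ n * volr (sball 1)).
  by rewrite mulr_ge0 ?volr_ge0// exprn_ge0// addr_ge0 ?nrm_ge0.
move=> s s0; have p1 : 0 < nrm p + 1 by have := nrm_ge0 p; lra.
have s1 : 0 < 1 + s by lra.
rewrite mulrAC -exprMn -volr_sball ?mulr_gt0//.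
apply: volr_le; [exact: compact_parallel|exact: compact_sball|].
move=> _ [x Kx [y ys <-]]; rewrite /sball /=.
apply: le_trans (nrm_triangle _ _) _; have := pmax _ (mem_set Kx).
have := nrm_ge0 p; move: ys; rewrite /sball /=; nra.
Qed.

(* For [k0] in the convex set [K], [K + e k0] lies in [(1 + e) K]. *)
Lemma parallel_vol_dilate K s e : K !=set0 -> compact K -> cvx K -> 0 <= e ->
  parallel_vol K ((1 + e) * s) <= (1 + e) ^+ n * parallel_vol K s.
Proof.
move=> [k0 Kk0] cK xK e0; have e1 : 0 < 1 + e by lra.
have c1 := @compact_parallel K s cK; have c2 := @compact_parallel K ((1 + e) * s) cK.
rewrite /parallel_vol -(volr_affine 0 e1 c1).
rewrite -[leLHS]mul1r -{1}(expr1n R n) -(volr_affine (e *: k0) ltr01 c2).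
apply: volr_le; [exact: compact_affine|exact: compact_affine|].
move=> _ [_ [k Kk [y ys <-]] <-].
exists (((1 - e / (1 + e)) *: k + (e / (1 + e)) *: k0) + (1 + e)^-1 *: y).
  exists ((1 - e / (1 + e)) *: k + (e / (1 + e)) *: k0).
    apply: xK => //; rewrite divr_ge0 ?(ltW e1)//= ler_pdivrMr//; lra.
  exists ((1 + e)^-1 *: y) => //; move: ys; rewrite /sball /= => ys.
  by rewrite nrmZ gtr0_norm ?invr_gt0// mulrC ler_pdivrMr// mulrC.
by apply/rowP => i; rewrite !mxE; field; rewrite gt_eqF.
Qed.

(** A zonotope between the unit ball and its (1 + e)-dilate gives a polynomial in [s] between the
    parallel volumes at [s] and (1 + e) s; its growth bounds its degree. *)
Lemma parallel_vol_squeeze K e : K !=set0 -> compact K -> cvx K -> 0 < e ->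
  exists2 q : {poly R}, (size q <= n.+1)%N & forall s, 0 <= s ->
    parallel_vol K s <= q.[s] <= (1 + e) ^+ n * parallel_vol K s.
Proof.
move=> K0 cK xK e0; have [vs hvs] := @zonotope_approx R n e e0.
have [q hq] := volr_zonotope_poly vs cK xK.
have bounds s : 0 <= s -> parallel_vol K s <= q.[s] <= (1 + e) ^+ n * parallel_vol K s.
  move=> s0; rewrite -hq//.
  have cZ : compact (msum K (zonotope s vs)).
    by apply: compact_msum => //; exact: compact_zonotope.
  apply/andP; split.
    apply: volr_le => //; first exact: compact_parallel.
    apply: subset_msum => x xs; apply: zonotope_separation => // u.
    have /andP[h _] := hvs u.
    by apply: le_trans (CauchySchwarz _ _) _; apply: ler_pM => //; exact: nrm_ge0.
  apply: le_trans (parallel_vol_dilate s K0 cK xK (ltW e0)).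
  apply: volr_le => //; first exact: compact_parallel.
  (* Testing against the direction [z] itself gives |z|^2 <= s (1 + e) |z|. *)
  apply: subset_msum => z /zonotope_dot_le => /(_ z); rewrite -sqr_nrm => h.
  have /andP[_ h2] := hvs z.
  have [z0|z0] := eqVneq (nrm z) 0.
    by rewrite /sball /= z0 mulr_ge0//; lra.
  have zp : 0 < nrm z by rewrite lt_neqAle eq_sym z0 nrm_ge0.
  rewrite /sball /= -(ler_pM2r zp) -expr2; apply: le_trans h _.
  by rewrite (mulrC (1 + e)) -mulrA ler_wpM2l.
exists q => //; have [C C0 hC] := parallel_vol_growth cK.
apply: (@size_poly_growth _ _ ((1 + e) ^+ n * C)) => s s0.
have /andP[h1 h2] := bounds s s0.
rewrite ger0_norm; last exact: le_trans (volr_ge0 _) h1.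
apply: le_trans h2 _; rewrite -mulrA ler_wpM2l ?exprn_ge0 ?hC//; lra.
Qed.

(** The candidate [p] interpolates at 0, ..., n. A squeezing polynomial equals its own interpolant
    there and is within O(e) of [parallel_vol K], both at the nodes and at [s]; now let [e] tend to
    0. *)
Lemma parallel_vol_poly K : K !=set0 -> compact K -> cvx K ->
  exists2 p : {poly R}, (size p <= n.+1)%N &
    forall s, 0 <= s -> parallel_vol K s = p.[s].
Proof.
move=> K0 cK xK; pose x (i : nat) : R := i%:R.
have xinj : injective x by move=> i j /eqP; rewrite eqr_nat => /eqP.
pose L (i : 'I_n.+1) : {poly R} := tnth (lagrange n.+1 x) i.
pose p := \sum_(i < n.+1) (parallel_vol K i%:R)%:P * L i.
have sp : (size p <= n.+1)%N.
  apply: leq_trans (size_sum _ _ _) _; apply/bigmax_leqP => i _; rewrite mul_polyC.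
  by apply: leq_trans (size_scale_leq _ _) _; rewrite /L size_lagrange_.
exists p => // s s0.
pose D := 2 ^+ n * (parallel_vol K s + \sum_(i < n.+1) parallel_vol K i%:R * `|(L i).[s]|).
have key e : 0 < e <= 1 -> `|parallel_vol K s - p.[s]| <= e * D.
  move=> /andP[e0 e1]; have [q sq hq] := parallel_vol_squeeze K0 cK xK e0.
  have near r : 0 <= r -> `|q.[r] - parallel_vol K r| <= e * (2 ^+ n * parallel_vol K r).
    move=> r0; have /andP[h1 h2] := hq r r0.
    rewrite ger0_norm ?subr_ge0//.
    have := exprD1_le n (_ : 0 <= e <= 1); rewrite (ltW e0) e1 => /(_ isT) h3.
    have := ler_wpM2r (volr_ge0 (msum K (sball r))) h3; rewrite -/(parallel_vol K r).
    have := volr_ge0 (msum K (sball r)); rewrite -/(parallel_vol K r).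
    move: h2; move: (parallel_vol K r) q.[r] ((1 + e) ^+ n) (2 ^+ n) => A B C D'.
    by nra.
  have qE : q.[s] = \sum_(i < n.+1) q.[i%:R] * (L i).[s].
    rewrite {1}(lagrange_gen (x := x) _ xinj sq)// horner_sum.
    by apply: eq_bigr => i _; rewrite hornerM hornerC.
  have pE : p.[s] = \sum_(i < n.+1) parallel_vol K i%:R * (L i).[s].
    by rewrite horner_sum; apply: eq_bigr => i _; rewrite hornerM hornerC.
  have -> : parallel_vol K s - p.[s] = - (q.[s] - parallel_vol K s) + (q.[s] - p.[s]) by ring.
  apply: le_trans (ler_normD _ _) _; rewrite normrN /D !mulrDr lerD ?near//.
  rewrite qE pE -sumrB; apply: le_trans (ler_norm_sum _ _ _) _.
  rewrite !mulr_sumr; apply: ler_sum => i _; rewrite -mulrBl normrM !mulrA ler_wpM2r//.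
  by rewrite -mulrA near.
apply/eqP; rewrite -subr_eq0; apply/negP => /negP d0.
have d : 0 < `|parallel_vol K s - p.[s]| by rewrite normr_gt0.
have D0 : 0 <= D.
  rewrite mulr_ge0 ?exprn_ge0// addr_ge0 ?volr_ge0// sumr_ge0// => i _.
  by rewrite mulr_ge0// volr_ge0.
set m := `|_ - _| in key d.
(* For this [e] the bound would give m + 2 D <= D with m > 0 and D >= 0. *)
have := key (m / (m + D + D)).
have mD : 0 < m + D + D by lra.
rewrite divr_gt0//= ler_pdivrMr// mul1r => /(_ _).
have -> : m <= m + D + D by lra.
move=> /(_ isT); rewrite mulrAC ler_pdivlMr//.
by rewrite ler_pM2l//; lra.
Qed.

(** Divides the coefficients of the parallel volume by the [kappa]; their nonvanishing is supplied
    by [kappa_gt0]. *)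
Lemma steiner_exists K : K !=set0 -> compact K -> cvx K -> (forall j, kappa R j != 0) ->
  exists V, steiner_formula K V.
Proof.
move=> K0 cK xK k0; have [p sp hp] := parallel_vol_poly K0 cK xK.
exists (fun i => p`_(n - i) / kappa R (n - i)) => s s0.
rewrite dilate_ball2// -/(sball s) volrE; last exact: compact_parallel.
congr EFin; rewrite -/(parallel_vol K s) hp// (horner_coef_wide _ sp).
rewrite (reindex_inj rev_ord_inj); apply: eq_bigr => i _ /=.
by rewrite subSS; field.
Qed.

End steiner.

(** * Moments of the volumes of balls *)

Section ball_moments.
Context {R : realType}.
Let mR := measurableTypeR R.
Let g : R := Num.sqrt pi.

Definition sqsum n (t : n.-tuple mR) : R := \sum_(i < n) tnth t i ^+ 2.

Lemma measurable_sqsum n : measurable_fun [set: n.-tuple mR] (@sqsum n).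
Proof.
rewrite /sqsum; apply: measurable_sum => i.
by apply: measurable_funX; exact: measurable_tnth.
Qed.

Lemma measurable_gauss_sqsum n :
  measurable_fun [set: n.-tuple mR] (fun t => expR (- sqsum t)).
Proof.
apply: measurableT_comp; first exact: measurable_expR.
by apply: measurable_funN; exact: measurable_sqsum.
Qed.

Lemma sqsum_consT n (x : mR) (t : n.-tuple mR) :
  sqsum (consT (x, t)) = x ^+ 2 + sqsum t.
Proof.
rewrite /sqsum big_ord_recl tnth0; congr (_ + _).
by apply: eq_bigr => i _; rewrite tnthS.
Qed.

Lemma integral_gauss_tuple n :
  (\int[lebesgue_tuple R n]_t (expR (- sqsum t))%:E = (g ^+ n)%:E)%E.
Proof.
elim: n => [|n IH].
  have mf := @measurable_gauss_sqsum 0; move/measurable_EFinP in mf.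
  rewrite [LHS](integral_dirac _ _ mf)// diracT mul1e expr0.
  by rewrite /=  /sqsum big_ord0 oppr0 expR0.
transitivity (\int[pushforward (@lebesgue_measure R \x lebesgue_tuple R n) (@consT R n)]_t (expR (- sqsum t))%:E)%E.
  by [].
rewrite ge0_integral_pushforward//=; last 2 first.
- exact: measurable_consT.
- by apply/measurable_EFinP; exact: measurable_gauss_sqsum.
rewrite preimage_setT fubini_tonelli1/=; last 2 first.
- apply/measurable_EFinP; apply: (measurableT_comp (@measurable_gauss_sqsum n.+1)).
  exact: measurable_consT.
- by move=> t; rewrite lee_fin expR_ge0.
transitivity (\int[lebesgue_measure]_x ((g ^+ n)%:E * (gauss_fun x)%:E))%E.
  apply: eq_integral => x _; rewrite /fubini_F /=.
  under eq_integral => t _ do rewrite sqsum_consT opprD expRD EFinM.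
  rewrite ge0_integralZl//.
  - by rewrite IH muleC.
  - by apply/measurable_EFinP; exact: measurable_gauss_sqsum.
rewrite ge0_integralZl//.
- by rewrite integralT_gauss -EFinM exprSr.
- by apply/measurable_EFinP; exact: measurable_gauss_fun.
- by move=> x _; rewrite lee_fin gauss_fun_ge0.
- by rewrite lee_fin exprn_ge0// sqrtr_ge0.
Qed.

(** For 0 < t <= 1, the radius of the ball where exp(-|x|^2) >= t. *)
Definition level (t : R) : R := Num.sqrt (- ln t).

Lemma measurable_levelX n : measurable_fun [set: mR] (fun t => level t ^+ n).
Proof.
apply: measurable_funX; apply: measurableT_comp.
  by apply: continuous_measurable_fun; exact: sqrt_continuous.
by apply: measurableT_comp => //; exact: measurable_ln.
Qed.

Lemma gauss_level_le n (x : n.-tuple mR) t : 0 < t <= 1 ->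
  (t <= expR (- sqsum x)) = (nrm (rowt x) <= level t).
Proof.
move=> /andP[t0 t1]; rewrite -[in LHS](lnK (x := t)) ?posrE// ler_expR lerNr.
have -> : sqsum x = nrm (rowt x) ^+ 2.
  by rewrite sqr_nrm; apply: eq_bigr => i _; rewrite mxE expr2.
have lt0 : 0 <= - ln t by rewrite oppr_ge0 ln_le0.
by rewrite -[in LHS](sqr_sqrtr lt0) ler_sqr ?nnegrE ?nrm_ge0// sqrtr_ge0.
Qed.

Lemma kappaE n : vol (@ball2 R n) = (kappa R n)%:E.
Proof. by rewrite ball2E volrE ?/kappa ?ball2E//; exact: compact_sball. Qed.

Lemma kappa_ge0 n : 0 <= kappa R n.
Proof. exact: volr_ge0. Qed.

(** Heights are restricted to ]0, 1[, where [level] is positive, as [volr_sball] asks of a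
    radius. *)
Definition gauss_body n : set (n.-tuple mR * mR) :=
  [set p | `]0, 1[%classic p.2 /\ p.2 <= expR (- sqsum p.1)].

Lemma measurable_gauss_body n : measurable (@gauss_body n).
Proof.
rewrite (_ : gauss_body (n := n) = (snd @^-1` `]0, 1[%classic) `&`
    ((fun p : n.-tuple mR * mR => expR (- sqsum p.1) - p.2) @^-1` `[0, +oo[%classic)).
  apply: measurableI.
    by rewrite -[X in measurable X]setTI; exact: measurable_snd.
  rewrite -[X in measurable X]setTI.
  apply: measurable_funB => //.
  by apply: (measurableT_comp (@measurable_gauss_sqsum n)).
by apply/seteqP; split => p /= []; rewrite /gauss_body /= !in_itv /= subr_ge0 andbT.
Qed.

(* Tonelli on the subgraph of the Gaussian: its vertical sections are intervals,
   its horizontal ones are balls of radius [level t]. *)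
Lemma kappa_moment n :
  ((kappa R n)%:E * \int[lebesgue_measure]_(t in `]0%R, 1%R[) (level t ^+ n)%:E =
   (g ^+ n)%:E)%E.
Proof.
rewrite -integral_gauss_tuple.
have := indic_fubini_tonelli (lebesgue_tuple R n) (@lebesgue_measure R) (@measurable_gauss_body n).
rewrite indic_fubini_tonelli_FE; last exact: measurable_gauss_body.
rewrite indic_fubini_tonelli_GE; last exact: measurable_gauss_body.
move=> e; transitivity (\int[lebesgue_tuple R n]_x (lebesgue_measure \o xsection (@gauss_body n)) x)%E; last first.
  apply: eq_integral => t _ /=; rewrite xsectionE.
  set c := expR _; have c0 : 0 < c by exact: expR_gt0.
  have c1 : c <= 1.
    rewrite -expR0 ler_expR lerNl oppr0; apply: sumr_ge0 => i _; exact: sqr_ge0.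
  have [c1'|c1'] := ltP c 1.
    rewrite (_ : _ @^-1` _ = `]0, c]%classic).
      by rewrite lebesgue_measure_itv /= lte_fin c0 -EFinB subr0.
    apply/seteqP; split => x /=; rewrite /gauss_body /= !in_itv /= -/c.
      by move=> [/andP[-> _] ->].
    by move=> /andP[-> h]; rewrite h (le_lt_trans h).
  (* At the peak of the Gaussian the section is ]0, 1[ instead of ]0, c]; its length is still
     [c]. *)
  have -> : c = 1 by apply/eqP; rewrite eq_le c1.
  rewrite (_ : _ @^-1` _ = `]0, 1[%classic).
    by rewrite lebesgue_measure_itv /= lte_fin ltr01 -EFinB subr0.
  apply/seteqP; split => x /=; rewrite /gauss_body /= !in_itv /= -/c; first by case.
  by move=> /andP[-> h]; rewrite h (le_trans (ltW h)).
rewrite e -ge0_integralZl//.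
- rewrite [LHS]integral_mkcond; apply: eq_integral => t _ /=.
  rewrite patchE; case: ifPn; rewrite ?inE ?notin_setE /= in_itv /=.
    move=> /andP[t0 t1]; rewrite ysectionE.
    have l0 : 0 < level t by rewrite sqrtr_gt0 oppr_gt0 ln_lt0// t0.
    rewrite -kappaE muleC ball2E -/(sball 1) !volrE; [|exact: compact_sball..].
    rewrite -EFinM -volr_sball// -volrE; last exact: compact_sball.
    congr (lebesgue_tuple R n _); apply/seteqP; split => x /=;
      rewrite /sball /gauss_body /= in_itv /= t0 t1 /= gauss_level_le ?t0 ?(ltW t1)//.
    by case.
  move=> nt; rewrite -[LHS](measure0 (lebesgue_tuple R n)); congr (lebesgue_tuple R n _).
  by apply/esym; rewrite -subset0 => x; rewrite ysectionE /gauss_body /= in_itv => -[].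
- by apply/measurable_EFinP; apply: measurable_funTS; exact: measurable_levelX.
- by move=> t _; rewrite lee_fin exprn_ge0// sqrtr_ge0.
- by rewrite lee_fin kappa_ge0.
Qed.

Let g0 : 0 < g.
Proof. by rewrite sqrtr_gt0 pi_gt0. Qed.

(** If [kappa R n] vanished, the left-hand side of [kappa_moment] would be 0, even for an infinite
    integral. *)
Lemma kappa_gt0 n : 0 < kappa R n.
Proof.
rewrite lt_neqAle kappa_ge0 andbT eq_sym; apply/negP => /eqP k0.
have := kappa_moment n; rewrite k0 mul0e => -[/esym/eqP].
by rewrite gt_eqF// exprn_gt0.
Qed.

Lemma level_moment n :
  (\int[lebesgue_measure]_(t in `]0%R, 1%R[) (level t ^+ n)%:E =
   (g ^+ n / kappa R n)%:E)%E.
Proof.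
have := kappa_moment n; have k0 := kappa_gt0 n.
case: (integral _ _ _) => [r||]; last 2 first.
- by rewrite gt0_muley ?lte_fin.
- by rewrite gt0_muleNy ?lte_fin.
move=> [<-]; congr EFin; field; exact: lt0r_neq0.
Qed.

Lemma integrable_levelX n :
  (@lebesgue_measure R).-integrable `]0%R, 1%R[ (fun t => (level t ^+ n)%:E).
Proof.
apply/integrableP; split.
  by apply/measurable_EFinP; apply: measurable_funTS; exact: measurable_levelX.
under eq_integral => t _.
  rewrite gee0_abs; last by rewrite lee_fin exprn_ge0// sqrtr_ge0.
  over.
by rewrite level_moment ltry.
Qed.

(* The functional [s ^ i |-> 1 / kappa_i] is integration against the law of
   [level t / g], with [t] uniform in ]0, 1[, hence positive. *)
Lemma kappa_positive N (c : nat -> R) :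
  (forall s, 0 <= s -> 0 <= \sum_(i < N) kappa R i * c i * s ^+ i) ->
  0 <= \sum_(i < N) c i.
Proof.
(* Coefficients after substituting s = [level t] / g; by [level_moment] the i-th term then
   integrates to [c i]. *)
move=> h; pose a i := kappa R i * c i / g ^+ i.
have [_ <-] : (@lebesgue_measure R).-integrable `]0%R, 1%R[
      (EFin \o (fun t => \sum_(i < N) a i * level t ^+ i)) /\
    \int[lebesgue_measure]_(t in `]0%R, 1%R[) (\sum_(i < N) a i * level t ^+ i)
    = \sum_(i < N) c i.
  elim: N {h} => [|N [i1 i2]].
    split; last by under eq_Rintegral do rewrite big_ord0; rewrite Rintegral_cst// mul0r big_ord0.
    rewrite (_ : _ \o _ = cst 0%E); first exact: integrable0.
    by apply/funext => t /=; rewrite big_ord0.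
  have i3 : (@lebesgue_measure R).-integrable `]0%R, 1%R[ (EFin \o (fun t => a N * level t ^+ N)).
    exact: integrableZl (integrable_levelX N).
  split.
    apply: eq_integrable (integrableD _ i1 i3) => // t _ /=.
    by rewrite big_ord_recr.
  under eq_Rintegral do rewrite big_ord_recr /=.
  rewrite RintegralD// i2 big_ord_recr /= RintegralZl//; last exact: integrable_levelX.
  congr (_ + _); rewrite /Rintegral level_moment /= /a.
  by field; rewrite (lt0r_neq0 (kappa_gt0 N)) expf_neq0 ?lt0r_neq0.
apply: Rintegral_ge0 => t _.
have := h (level t / g) (divr_ge0 (sqrtr_ge0 _) (ltW g0)).
congr (_ <= _); apply: eq_bigr => i _; rewrite /a expr_div_n.
by field; rewrite expf_neq0 ?lt0r_neq0.
Qed.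

End ball_moments.

(** * The inequality *)

(** Take [x0] in [X] with largest and [y0] in [Y] with smallest first coordinate. The translates X +
    y0 and Y + x0 lie in the sum, on opposite sides of a hyperplane. *)
Lemma volr_superadditive (R : realType) n (X Y : set 'rV[R]_n.+1) :
  X !=set0 -> Y !=set0 -> compact X -> compact Y ->
  volr X + volr Y <= volr (msum X Y).
Proof.
move=> X0 Y0 cX cY.
have cc : continuous (fun x : 'rV[R]_n.+1 => x ord0 ord0) by exact: coord_continuous.
have [x0 + xmax] := compact_EVT_max X0 cX (continuous_subspaceT cc).
have [y0 + ymin] := compact_EVT_min Y0 cY (continuous_subspaceT cc).
rewrite !inE => Yy0 Xx0.
have t (v : 'rV[R]_n.+1) (Z : set 'rV[R]_n.+1) : compact Z -> volr Z = volr [set 1 *: x + v | x in Z].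
  by move=> cZ; rewrite volr_affine// expr1n mul1r.
rewrite (t y0 X cX) (t x0 Y cY).
apply: (@volr_setU_le _ _ _ _ _ (x0 ord0 ord0 + y0 ord0 ord0)).
- exact: compact_affine.
- exact: compact_affine.
- exact: compact_msum.
- by move=> _ [x Xx <-]; exists x => //; exists y0 => //; rewrite scale1r.
- by move=> _ [y Yy <-]; exists x0 => //; exists y => //; rewrite scale1r addrC.
- by move=> _ [x Xx <-]; rewrite scale1r mxE lerD2r; apply: xmax; rewrite inE.
- by move=> _ [y Yy <-]; rewrite scale1r mxE [leLHS]addrC lerD2r; apply: ymin; rewrite inE.
Qed.

(** * From parallel volumes to the Wills functional *)

Section wills.
Context {R : realType}.

(** Here [c j] is the intrinsic volume of index n - j, paired with s^j. Existence of a solution of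
    Steiner's formula ensures that [xget] returns one. *)
Lemma wills_steiner n (K : set 'rV[R]_n) : K !=set0 -> compact K -> cvx K ->
  exists2 c : nat -> R, wills K = \sum_(j < n.+1) c j &
    forall s, 0 <= s -> parallel_vol K s = \sum_(j < n.+1) kappa R j * c j * s ^+ j.
Proof.
move=> K0 cK xK.
have [V0 hV0] : exists V, steiner_formula K V.
  by apply: steiner_exists => // j; rewrite lt0r_neq0// kappa_gt0.
have hV : steiner_formula K (intrinsic_volume K) by exact: (xgetI _ hV0).
have rev (F : 'I_n.+1 -> R) : \sum_i F i = \sum_(j < n.+1) F (inord (n - j)).
  rewrite (reindex_inj rev_ord_inj); apply: eq_bigr => i _; congr F.
  by apply: val_inj; rewrite /= inordK ?subSS// ltnS leq_subr.
exists (fun j => intrinsic_volume K (inord (n - j))); first exact: rev.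
move=> s s0; have := hV s s0; rewrite dilate_ball2// -/(sball s) volrE; last exact: compact_parallel.
rewrite /parallel_vol => -[->]; rewrite rev; apply: eq_bigr => j _.
by rewrite inordK ?ltnS ?leq_subr// subKn// -ltnS.
Qed.

Lemma wills_ge0 n (K : set 'rV[R]_n) : K !=set0 -> compact K -> cvx K -> 0 <= wills K.
Proof.
move=> K0 cK xK; have [c -> hc] := wills_steiner K0 cK xK.
by apply: kappa_positive => s s0; rewrite -hc// volr_ge0.
Qed.

(** Since a + b = 1 and balls are convex, a (K + s B) + b (L + s B) lies in the parallel body of a K
    + b L; then use superadditivity and homogeneity of volume. *)
Lemma parallel_vol_mean n (K L : set 'rV[R]_n.+1) (a b s : R) :
  K !=set0 -> L !=set0 -> compact K -> compact L -> 0 < a -> 0 < b -> a + b = 1 ->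
  0 <= s ->
  a ^+ n.+1 * parallel_vol K s + b ^+ n.+1 * parallel_vol L s <=
  parallel_vol (msum (dilate a K) (dilate b L)) s.
Proof.
move=> [k Kk] [l Ll] cK cL a0 b0 ab s0.
have cKs := @compact_parallel _ _ K s cK; have cLs := @compact_parallel _ _ L s cL.
rewrite -(volr_affine 0 a0 cKs) -(volr_affine 0 b0 cLs) -!dilateE.
have ss : sball s (0 : 'rV[R]_n.+1) by rewrite /sball /= nrm0.
apply: (@le_trans _ _ (volr (msum (dilate a (msum K (sball s))) (dilate b (msum L (sball s)))))).
  apply: volr_superadditive; try exact: compact_dilate.
    by exists (a *: (k + 0)); exists (k + 0) => //; exists k => //; exists 0.
  by exists (b *: (l + 0)); exists (l + 0) => //; exists l => //; exists 0.
apply: volr_le.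
- by apply: compact_msum; exact: compact_dilate.
- by apply: compact_parallel; apply: compact_msum; exact: compact_dilate.
- move=> _ [_ [_ [x Kx [u us <-]] <-] [_ [_ [y Ly [v vs <-]] <-] <-]].
  exists (a *: x + b *: y).
    by exists (a *: x); [exists x|exists (b *: y) => //; exists y].
  exists (a *: u + b *: v); last by rewrite !scalerDr addrACA.
  move: us vs; rewrite /sball /= => us vs.
  apply: le_trans (nrm_triangle _ _) _; rewrite !nrmZ !gtr0_norm//.
  have -> : s = a * s + b * s by rewrite -mulrDl ab mul1r.
  by apply: lerD; rewrite ler_pM2l.
Qed.

(** [kappa_positive] applied to the difference of the Steiner polynomials turns the inequality for
    all parallel volumes into one for the Wills functional. *)
Lemma wills_mean n (K L : set 'rV[R]_n.+1) (a b : R) :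
  K !=set0 -> L !=set0 -> compact K -> compact L -> cvx K -> cvx L ->
  0 < a -> 0 < b -> a + b = 1 ->
  a ^+ n.+1 * wills K + b ^+ n.+1 * wills L <=
  wills (msum (dilate a K) (dilate b L)).
Proof.
move=> K0 L0 cK cL xK xL a0 b0 ab.
have [cc -> hK] := wills_steiner K0 cK xK.
have [d -> hL] := wills_steiner L0 cL xL.
have M0 : msum (dilate a K) (dilate b L) !=set0.
  have [k Kk] := K0; have [l Ll] := L0.
  by exists (a *: k + b *: l); exists (a *: k); [exists k|exists (b *: l) => //; exists l].
have cM : compact (msum (dilate a K) (dilate b L)).
  by apply: compact_msum; exact: compact_dilate.
have xM : cvx (msum (dilate a K) (dilate b L)).
  by apply: cvx_msum; exact: cvx_dilate.
have [e -> hM] := wills_steiner M0 cM xM.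
rewrite -subr_ge0 !mulr_sumr -big_split /= -sumrB.
apply: (@kappa_positive R _ (fun i => e i - (a ^+ n.+1 * cc i + b ^+ n.+1 * d i))) => s s0.
have := parallel_vol_mean K0 L0 cK cL a0 b0 ab s0.
rewrite hK// hL// hM// -subr_ge0 !mulr_sumr -big_split /= -sumrB.
by congr (_ <= _); apply: eq_bigr => i _; ring.
Qed.

(** The induction step uses (x + y)(x^m + y^m) <= 2 (x^(m+1) + y^(m+1)), that is (x - y)(x^m - y^m)
    >= 0, and 2 <= n + 2. *)
Lemma exprD_le_fact (x y : R) n : 0 <= x -> 0 <= y ->
  (x + y) ^+ n.+1 <= n.+1`!%:R * (x ^+ n.+1 + y ^+ n.+1).
Proof.
move=> x0 y0; elim: n => [|n IH]; first by rewrite !expr1 mul1r.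
have xy0 : 0 <= x + y by rewrite addr_ge0.
rewrite exprS; apply: le_trans (ler_wpM2l xy0 IH) _.
rewrite (factS n.+1) natrM [leLHS]mulrCA (mulrC n.+2%:R) -[leRHS]mulrA ler_wpM2l//.
apply: (@le_trans _ _ (2 * (x ^+ n.+2 + y ^+ n.+2))); last first.
  by rewrite ler_wpM2r ?addr_ge0 ?exprn_ge0// ler_nat.
rewrite !(exprS _ n.+1) -subr_ge0.
have -> : 2 * (x * x ^+ n.+1 + y * y ^+ n.+1) - (x + y) * (x ^+ n.+1 + y ^+ n.+1) =
  (x - y) * (x ^+ n.+1 - y ^+ n.+1) by ring.
have [xy|yx] := leP x y.
  by rewrite mulr_le0// subr_le0// lerXn2r.
by rewrite mulr_ge0// subr_ge0 ?(ltW yx)// lerXn2r// ?nnegrE ltW.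
Qed.

End wills.

(** [exprD_le_fact] with x and y the two weighted roots, whose powers of exponent n + 1 are the two
    terms of the hypothesis; then take roots. *)
Lemma root_mean_fact (R : realType) n (a b A B W : R) :
  0 <= a -> 0 <= b -> 0 <= A -> 0 <= B -> a ^+ n.+1 * A + b ^+ n.+1 * B <= W ->
  1 / (n.+1`!%:R `^ n.+1%:R^-1) * (a * A `^ n.+1%:R^-1 + b * B `^ n.+1%:R^-1) <=
  W `^ n.+1%:R^-1.
Proof.
move=> a0 b0 A0 B0 hW.
have nz : n.+1%:R != 0 :> R by rewrite pnatr_eq0.
have rootK (z : R) : 0 <= z -> (z `^ n.+1%:R^-1) ^+ n.+1 = z.
  by move=> z0; rewrite -powR_mulrn ?powR_ge0// -powRrM mulVf// powRr1.
have Kroot (z : R) : 0 <= z -> (z ^+ n.+1) `^ n.+1%:R^-1 = z.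
  by move=> z0; rewrite -powR_mulrn// -powRrM mulfV// powRr1.
have W0 : 0 <= W by apply: le_trans hW; rewrite addr_ge0// mulr_ge0// exprn_ge0.
have fpos : 0 < n.+1`!%:R :> R by rewrite ltr0n fact_gt0.
have f0 : 0 <= n.+1`!%:R :> R by exact: ltW.
have x0 : 0 <= a * A `^ n.+1%:R^-1 by rewrite mulr_ge0 ?powR_ge0.
have y0 : 0 <= b * B `^ n.+1%:R^-1 by rewrite mulr_ge0 ?powR_ge0.
have hxy := exprD_le_fact n x0 y0.
rewrite mul1r ler_pdivrMl ?powR_gt0// -powRM// -(Kroot _ (addr_ge0 x0 y0)).
apply: ge0_ler_powR; rewrite ?nnegrE ?invr_ge0 ?mulr_ge0 ?exprn_ge0 ?addr_ge0//.
by apply: le_trans hxy _; rewrite ler_pM2l// !exprMn !rootK.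
Qed.

Theorem theorem1p5 (R : realType) (n : nat) (hn : (0 < n)%N)
    (K L : set 'rV[R]_n) (hK : convex_body K) (hL : convex_body L)
    (lambda : R) (h0 : 0 < lambda) (h1 : lambda < 1) :
  wills (minkowski_sum (dilate (1 - lambda) K) (dilate lambda L)) `^ n%:R^-1 >=
  1 / (n`!%:R `^ n%:R^-1) *
  ((1 - lambda) * wills K `^ n%:R^-1 + lambda * wills L `^ n%:R^-1).
Proof.
case: n hn K L hK hL => // n _ K L hK hL.
have xK := convex_body_cvx hK; have xL := convex_body_cvx hL.
have [K0 cK _] := hK; have [L0 cL _] := hL.
have l1 : 0 < 1 - lambda by rewrite subr_gt0.
apply: root_mean_fact (ltW l1) (ltW h0) (wills_ge0 K0 cK xK) (wills_ge0 L0 cL xL) _.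
exact: wills_mean K0 L0 cK cL xK xL l1 h0 (subrK _ _).
Qed.
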